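(* Let $A=(a_{ij})$ be a $d\times n$ integer matrix whose columns span $\mathbb{Z}^d$. For generic $w\in\mathbb{Z}^n$ and generic $\beta\in\mathbb{C}^d$, $$\mathrm{in}_{\tau}(H_{A,w}(\beta)) = D\cdot \mathrm{in}_\tau(D\cdot I_{\tilde A}) + D\cdot \tilde A_{\theta,w,\beta},$$ where $\tau=(\mathbf{0},-1;\mathbf{0},1)$ is the weight vector giving weight $-1$ to $t$, weight $1$ to $\partial_t$, and weight $0$ to all $x_i$ and $\partial_i$.
   Context: $\mathbb{N}=\{0,1,2,\ldots\}$. $D=\mathbb{C}\langle x_1,\ldots,x_n,t,\partial_1,\ldots,\partial_n,\partial_t\rangle$ is the Weyl algebra in $n+1$ variables, where $\partial_i=\partial/\partial x_i$ and $\partial_t=\partial/\partial t$. Let $\tilde A$ be the $(d+1)\times(n+1)$ matrix $$\tilde A=\begin{pmatrix} a_{11}&\cdots&a_{1n}&0\\ \vdots& &\vdots&\vdots\\ a_{d1}&\cdots&a_{dn}&0\\ w_1&\cdots&w_n&1\end{pmatrix}.$$ $I_{\tilde A}$ is the toric ideal in the commutative polynomial ring $\mathbb{C}[\partial_1,\ldots,\partial_n,t]\subset D$ generated by all $\prod_{i=1}^n\partial_i^{u_i}\,t^{u_{n+1}}-\prod_{j=1}^n\partial_j^{v_j}\,t^{v_{n+1}}$ with $u,v\in\mathbb{N}^{n+1}$ and $\tilde Au=\tilde Av$. $\tilde A_{\theta,w,\beta}$ denotes the set of the $d+1$ Euler operators $\sum_{j=1}^n a_{ij}x_j\partial_j-\beta_i$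 ($i=1,\ldots,d$) and $\sum_{j=1}^n w_jx_j\partial_j-t\partial_t$. The modified $\mathcal{A}$-hypergeometric ideal $H_{A,w}(\beta)$ is the left ideal of $D$ generated by $\tilde A_{\theta,w,\beta}$ and $I_{\tilde A}$. Initial ideals: for a nonzero $\ell\in D$, written in normally ordered form as a $\mathbb{C}$-linear combination of monomials $x^bt^p\partial^c\partial_t^q$, the initial form $\mathrm{in}_\tau(\ell)\in D$ is the sum of those terms for which the $\tau$-weight $-p+q$ is maximal; for a left ideal $I$ of $D$, $\mathrm{in}_\tau(I)$ is the left ideal of $D$ consisting of all $\mathbb{C}$-linear combinations of $\mathrm{in}_\tau(\ell)$, $\ell\in I\setminus\{0\}$. For generic $w$, $\mathrm{in}_\tau(D\cdot I_{\tilde A})$ is generated by monomials in $\mathbb{C}[\partial_1,\ldots,\partial_n]$. Genericity: ''generic $w$'' means $w\in\mathbb{Z}^n$ outside a finite union of proper linear hyperplanes depending only on $A$; ''generic $\beta$'' means $\beta\in\mathbb{C}^d$ outside a proper Zariski closed subset of $\mathbb{C}^d$ (which may depend on $A$ and $w$). Thus the claim asserts that such exceptional sets exist with the equality holding for all $w,\beta$ outside them. *)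

(* Defs.v *)
From HB Require Import structures.
From mathcomp Require Import all_boot all_order all_algebra.
From mathcomp Require Import classical_sets complex reals.
From mathcomp Require Import mpoly.

Set Implicit Arguments.
Unset Strict Implicit.
Unset Printing Implicit Defensive.

Import GRing.Theory.

Local Open Scope ring_scope.
Local Open Scope classical_set_scope.

(* The Weyl algebra in N variables over R is carried by the polynomials in 2N *)
(* commuting variables: a polynomial stands for the operator obtained by      *)
(* reading each of its monomials in normally ordered form, where lshift N i   *)
(* indexes the variable x_i and rshift N i indexes the derivation d_i:        *)
(*   'X_[m]  <->  \prod_i x_i ^+ m (lshift N i) *                             *)
(*                \prod_i d_i ^+ m (rshift N i)      (see weyl_monomialE).    *)
(* The type weyl R N is this carrier equipped with the operator product; its  *)
(* zmodType and lmodType structures are those of the polynomials.             *)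

Section NormalOrdering.
Variables (R : comNzRingType) (N : nat).
Local Notation P := {mpoly R[N + N]}.
Implicit Types (p q r : P) (m : 'X_{1..N + N}).

Definition xpart m : P := \prod_(i < N) 'X_(lshift N i) ^+ m (lshift N i).

(* Normal ordering of d_i * q: moving d_i to the right of the x's in each     *)
(* monomial x^b d^c of q gives x^b d^c d_i + (b_i x^(b - e_i)) d^c.           *)
Definition dmul (i : 'I_N) q : P := 'X_(rshift N i) * q + q^`M(lshift N i).

Definition dpow m q : P :=
  foldr (fun i => iter (m (rshift N i)) (dmul i)) q (enum 'I_N).

Definition weyl_mul p q : P :=
  \sum_(m <- msupp p) p@_m *: (xpart m * dpow m q).

Lemma dmul_is_linear i : linear (dmul i).
Proof.
by move=> c p q; rewrite /dmul mderivD mderivZ mulrDr scalerDr -scalerAr addrACA.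
Qed.

Lemma dmulE i q : dmul i q = 'X_(rshift N i) * q + q^`M(lshift N i).
Proof. by []. Qed.

HB.instance Definition _ i :=
  GRing.isLinear.Build R P P *:%R (dmul i) (dmul_is_linear i).

Lemma dpow_is_linear m : linear (dpow m).
Proof.
move=> c p q; rewrite /dpow; elim: (enum _) => //= i s ->.
by elim: (m _) => //= k ->; rewrite linearP.
Qed.

HB.instance Definition _ m :=
  GRing.isLinear.Build R P P *:%R (dpow m) (dpow_is_linear m).

Lemma mderivXX (i j : 'I_(N + N)) :
  ('X_j : P)^`M(i) = (i == j)%:R.
Proof.
rewrite mderivX mnm1E eq_sym; case: eqP => [->|_]; last by rewrite scale0r.
have -> : (U_(j) - U_(j) = 0 :> 'X_{1..N + N})%MM.
  by apply/mnmP=> k; rewrite mnmBE mnm0E subnn.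
by rewrite mpolyX0 scale1r.
Qed.

Lemma dmulX i j q :
  dmul i ('X_(lshift N j) * q) =
  'X_(lshift N j) * dmul i q + (i == j)%:R * q.
Proof.
rewrite !dmulE mderivM mderivXX eq_lshift mulrDr mulrCA -!addrA.
by congr (_ + _); rewrite addrC.
Qed.

Lemma dmulC i j q : dmul i (dmul j q) = dmul j (dmul i q).
Proof.
rewrite !dmulE !mderivD !mderivM !mderivXX !eq_lrshift !mul0r !add0r !mulrDr.
rewrite mulrCA (mderiv_comm (lshift N i)) -!addrA; congr (_ + _).
by rewrite addrCA.
Qed.

Lemma dmul_iterC i j k q :
  dmul i (iter k (dmul j) q) = iter k (dmul j) (dmul i q).
Proof. by elim: k => //= k <-; rewrite dmulC. Qed.

Lemma dpow_foldr_dmul m i s q :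
  foldr (fun i => iter (m (rshift N i)) (dmul i)) (dmul i q) s =
  dmul i (foldr (fun i => iter (m (rshift N i)) (dmul i)) q s).
Proof. by elim: s => //= j s ->; rewrite dmul_iterC. Qed.

Lemma dpowS m i q : dpow (U_(rshift N i) + m) q = dmul i (dpow m q).
Proof.
rewrite /dpow; set g := fun j => _.
have: i \in enum 'I_N by rewrite mem_enum.
have := enum_uniq 'I_N.
elim: (enum _) => //= j s IHs /andP[jNs us]; rewrite inE /g mnmDE mnm1E.
rewrite eq_rshift; case: eqVneq => [-> _ | ij /= is_].
  rewrite add1n iterS; congr (dmul _ (iter _ _ _)).
  elim: s jNs {IHs us} => //= k s IHs; rewrite inE negb_or => /andP[jk jNs].
  by rewrite mnmDE mnm1E eq_rshift (negbTE jk) add0n IHs.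
by rewrite add0n dmul_iterC IHs.
Qed.

Lemma dpowSx m i q : dpow (U_(lshift N i) + m) q = dpow m q.
Proof.
rewrite /dpow; elim: (enum _) => //= j s ->.
by rewrite mnmDE mnm1E eq_lrshift add0n.
Qed.

Lemma dpow0 q : dpow 0%MM q = q.
Proof. by rewrite /dpow; elim: (enum _) => //= i s ->; rewrite mnm0E. Qed.

Lemma xpartS m i : xpart (U_(lshift N i) + m) = 'X_(lshift N i) * xpart m.
Proof.
rewrite /xpart (bigD1 i) //= [X in _ = _ * X](bigD1 i) //= mulrA -exprS.
congr (_ * _); first by rewrite mnmDE mnm1E eqxx.
by apply: eq_bigr => j ji; rewrite mnmDE mnm1E eq_lshift eq_sym (negbTE ji).
Qed.

Lemma xpartSd m i : xpart (U_(rshift N i) + m) = xpart m.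
Proof. by apply: eq_bigr => j _; rewrite mnmDE mnm1E eq_rlshift. Qed.

Lemma xpart0 : xpart 0%MM = 1.
Proof. by apply: big1 => i _; rewrite mnm0E expr0. Qed.

Lemma mnm_x_ind (K : 'X_{1..N + N} -> Prop) :
    (forall m, (forall i, m (lshift N i) = 0%N) -> K m) ->
    (forall i m, K m -> K (U_(lshift N i) + m)%MM) ->
  forall m, K m.
Proof.
move=> K0 Kx m; elim: {m}(mdeg m) {-2}m (erefl (mdeg m)) => [|k IHk] m mk.
  by apply: K0 => i; move/eqP: mk; rewrite mdeg_eq0 => /eqP ->; rewrite mnm0E.
have [/forallP m0|/forallPn[i mi]] :=
  boolP [forall i, m (lshift N i) == 0%N]; first by apply: K0 => i; apply/eqP.
have Um : (U_(lshift N i) <= m)%MM by rewrite lep1mP.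
move: mk; rewrite -(submK Um) addmC mdegD mdeg1 => -[mk].
exact/Kx/IHk.
Qed.

Lemma weyl_mulwE (s : seq 'X_{1..N + N}) p q :
    uniq s -> {subset msupp p <= s} ->
  weyl_mul p q = \sum_(m <- s) p@_m *: (xpart m * dpow m q).
Proof.
move=> us sub; rewrite /weyl_mul [RHS](bigID (mem (msupp p))) /=.
rewrite [X in _ = _ + X]big1 ?addr0; last first.
  by move=> m /memN_msupp_eq0 ->; rewrite scale0r.
rewrite -[RHS]big_filter; apply: perm_big; apply: uniq_perm.
- exact: msupp_uniq.
- exact: filter_uniq.
by move=> m; rewrite mem_filter /=; case: (boolP (m \in msupp p)) => //= /sub ->.
Qed.

Lemma weyl_mul_is_linearl q : linear (weyl_mul^~ q).
Proof.
move=> c p r; pose s := undup (msupp p ++ msupp r ++ msupp (c *: p + r)).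
have us : uniq s by exact: undup_uniq.
rewrite !(@weyl_mulwE s) // => [|m mr|m mp|m mpr]; last first.
- by rewrite mem_undup !mem_cat mpr !orbT.
- by rewrite mem_undup !mem_cat mp.
- by rewrite mem_undup !mem_cat mr !orbT.
rewrite scaler_sumr -big_split /=; apply: eq_bigr => m _.
by rewrite mcoeffD mcoeffZ scalerDl scalerA.
Qed.

Lemma weyl_mul_is_linearr p : linear (weyl_mul p).
Proof.
move=> c q r; rewrite /weyl_mul scaler_sumr -big_split /=; apply: eq_bigr => m _.
by rewrite linearP mulrDr -scalerAr scalerDr !scalerA mulrC.
Qed.

Lemma weyl_mulDl : left_distributive weyl_mul +%R.
Proof.
by move=> p q r; have := weyl_mul_is_linearl r 1 p q; rewrite !scale1r.
Qed.

Lemma weyl_mulDr : right_distributive weyl_mul +%R.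
Proof.
by move=> p q r; have := weyl_mul_is_linearr p 1 q r; rewrite !scale1r.
Qed.

Lemma weyl_mul0l q : weyl_mul 0 q = 0.
Proof. by rewrite /weyl_mul msupp0 big_nil. Qed.

Lemma weyl_mul0r q : weyl_mul q 0 = 0.
Proof. by have := weyl_mulDr q 0 0; rewrite addr0 -{1}[weyl_mul q 0]addr0 => /addrI. Qed.

Lemma weyl_scaleAl c p q : c *: weyl_mul p q = weyl_mul (c *: p) q.
Proof.
by have := weyl_mul_is_linearl q c p 0; rewrite weyl_mul0l !addr0 => <-.
Qed.

Lemma weyl_scaleAr c p q : c *: weyl_mul p q = weyl_mul p (c *: q).
Proof.
by have := weyl_mul_is_linearr p c q 0; rewrite weyl_mul0r !addr0 => <-.
Qed.

Lemma weyl_mulX m q : weyl_mul 'X_[m] q = xpart m * dpow m q.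
Proof. by rewrite /weyl_mul msuppX big_seq1 mcoeffX eqxx scale1r. Qed.

Lemma weyl_mul_xl i p q :
  weyl_mul ('X_(lshift N i) * p) q = 'X_(lshift N i) * weyl_mul p q.
Proof.
elim/mpolyind: p => [|c m p _ _ IHp]; first by rewrite mulr0 weyl_mul0l mulr0.
rewrite mulrDr !weyl_mulDl mulrDr IHp; congr (_ + _).
rewrite -scalerAr -!weyl_scaleAl -scalerAr -mpolyXD !weyl_mulX.
by rewrite xpartS dpowSx mulrA.
Qed.

Lemma weyl_mul_dl i p q : weyl_mul (dmul i p) q = dmul i (weyl_mul p q).
Proof.
elim/mpolyind: p => [|c m p _ _ IHp]; first by rewrite linear0 weyl_mul0l linear0.
rewrite (linearD (dmul i)) (weyl_mulDl (dmul i _)) IHp.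
rewrite (weyl_mulDl (c *: _)) (linearD (dmul i)); congr (_ + _).
rewrite (linearZ_LR (dmul i)) -!weyl_scaleAl (linearZ_LR (dmul i)).
congr (_ *: _) => {c p IHp} /=.
elim/mnm_x_ind: m => [m m0|j m IHm].
  rewrite (dmulE i (mpolyX _ _)) mderivX m0 scale0r addr0 -mpolyXD !weyl_mulX dpowS xpartSd.
  by rewrite /xpart big1 ?mul1r // => j _; rewrite m0 expr0.
rewrite mpolyXD dmulX weyl_mulDl !weyl_mul_xl IHm dmulX; congr (_ + _).
by case: eqP => _; rewrite ?mul1r // !mul0r weyl_mul0l.
Qed.

Lemma weyl_mulA : associative weyl_mul.
Proof.
move=> p q r; elim/mpolyind: p => [|c m p _ _ IHp]; first by rewrite !weyl_mul0l.
rewrite !weyl_mulDl IHp -!weyl_scaleAl; congr (_ *: _ + _) => {c p IHp}.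
rewrite !weyl_mulX; elim/mnm_x_ind: m => [m m0|j m IHm]; last first.
  by rewrite xpartS !dpowSx -!mulrA weyl_mul_xl IHm.
rewrite /xpart big1 => [|i _]; rewrite ?m0 // !mul1r /dpow.
elim: (enum _) => //= i s; elim: (m _) => //= k IHk /IHk ->.
by rewrite weyl_mul_dl.
Qed.

Lemma weyl_mul1l : left_id 1 weyl_mul.
Proof. by move=> p; rewrite -mpolyX0 weyl_mulX xpart0 dpow0 mul1r. Qed.

Lemma dmul_d i p :
  (forall j, p^`M(lshift N j) = 0) -> dmul i p = 'X_(rshift N i) * p.
Proof. by move=> p0; rewrite dmulE p0 addr0. Qed.

Lemma dpow1 m : dpow m 1 = \prod_(i < N) 'X_(rshift N i) ^+ m (rshift N i).
Proof.
rewrite /dpow -big_enum /=; set s := enum _.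
suff: foldr (fun i => iter (m (rshift N i)) (dmul i)) 1 s =
      \prod_(i <- s) 'X_(rshift N i) ^+ m (rshift N i)
   /\ (forall j, (\prod_(i <- s) 'X_(rshift N i) ^+ m (rshift N i) : P)
                 ^`M(lshift N j) = 0) by case.
elim: s => [|i s [/= -> IHs]].
  by rewrite big_nil; split=> // j; rewrite -mpolyC1 mderivC.
rewrite big_cons; elim: (m _) => [|k [IHk dk]]; first by rewrite expr0 mul1r.
rewrite iterS IHk exprS -mulrA dmul_d //; split=> // j.
by rewrite mderivM mderivXX eq_lrshift mul0r add0r dk mulr0.
Qed.

Lemma mpolyX_split m : 'X_[m] = xpart m * dpow m 1.
Proof. by rewrite dpow1 mpolyXE_id big_split_ord. Qed.

Lemma weyl_mul1r : right_id 1 weyl_mul.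
Proof.
move=> p; elim/mpolyind: p => [|c m p _ _ IHp]; first by rewrite weyl_mul0l.
by rewrite weyl_mulDl IHp -weyl_scaleAl weyl_mulX -mpolyX_split.
Qed.

End NormalOrdering.

Definition weyl (R : comNzRingType) (N : nat) : Type := {mpoly R[N + N]}.

Section WeylRing.
Variables (R : comNzRingType) (N : nat).

HB.instance Definition _ := GRing.Lmodule.copy (weyl R N) {mpoly R[N + N]}.

HB.instance Definition _ := GRing.Zmodule_isNzRing.Build (weyl R N)
  (@weyl_mulA R N) (@weyl_mul1l R N) (@weyl_mul1r R N)
  (@weyl_mulDl R N) (@weyl_mulDr R N) (oner_neq0 {mpoly R[N + N]}).

HB.instance Definition _ :=
  GRing.Lmodule_isLalgebra.Build R (weyl R N) (@weyl_scaleAl R N).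

HB.instance Definition _ :=
  GRing.Lalgebra_isAlgebra.Build R (weyl R N) (@weyl_scaleAr R N).

End WeylRing.

Definition wx {R : comNzRingType} {N} (i : 'I_N) : weyl R N :=
  'X_(lshift N i) : {mpoly R[N + N]}.

Definition wd {R : comNzRingType} {N} (i : 'I_N) : weyl R N :=
  'X_(rshift N i) : {mpoly R[N + N]}.

Section WeylTheory.
Variables (R : comNzRingType) (N : nat).
Local Notation W := (weyl R N).

Lemma wx_mulE i (p : W) :
  wx i * p = ('X_(lshift N i) : {mpoly R[N + N]}) * (p : {mpoly R[N + N]}).
Proof.
have := @weyl_mul_xl R N i 1 p.
by rewrite weyl_mul1l mulr1.
Qed.

Lemma wd_mulE i (p : W) : wd i * p = dmul i (p : {mpoly R[N + N]}).
Proof.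
have := @weyl_mul_dl R N i 1 p.
by rewrite weyl_mul1l dmul_d ?mulr1 // => j; rewrite -mpolyC1 mderivC.
Qed.

Lemma wx_comm i j : wx i * wx j = wx j * wx i :> W.
Proof. by rewrite !wx_mulE mulrC. Qed.

Lemma wd_comm i j : wd i * wd j = wd j * wd i :> W.
Proof.
have wdE k : wd k = dmul k 1 :> W by rewrite -[LHS]mulr1 wd_mulE.
by rewrite !wd_mulE !wdE dmulC.
Qed.

Lemma wd_wx i j : wd i * wx j = wx j * wd i + (i == j)%:R :> W.
Proof.
have := @dmulX R N i j 1; rewrite !mulr1 => dX.
rewrite wd_mulE dX wx_mulE -[wd i]mulr1 wd_mulE.
by case: eqP.
Qed.

Lemma weyl_monomialE (m : 'X_{1..N + N}) :
  ('X_[m] : {mpoly R[N + N]}) =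
  \prod_(i < N) (wx i : W) ^+ m (lshift N i) *
  \prod_(i < N) (wd i : W) ^+ m (rshift N i) :> W.
Proof.
have enumE (V : nzRingType) (F : 'I_N -> V) :
    \prod_(i < N) F i = \prod_(i <- enum 'I_N) F i 
  by rewrite [index_enum _]unlock enumT.
have dE q : (\prod_(i < N) (wd i : W) ^+ m (rshift N i)) * q =
            dpow m (q : {mpoly R[N + N]}) :> W.
  rewrite enumE /dpow.
  elim: (enum _) q => [|i s IHs] q; first by rewrite big_nil mul1r.
  rewrite big_cons -mulrA IHs /=; elim: (m _) => [|k IHk].
    by rewrite expr0 mul1r.
  by rewrite exprS -mulrA IHk wd_mulE.
have xE q : (\prod_(i < N) (wx i : W) ^+ m (lshift N i)) * q =
            xpart R m * (q : {mpoly R[N + N]}) :> {mpoly R[N + N]}.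
  rewrite /xpart !enumE.
  elim: (enum _) q => [|i s IHs] q; first by rewrite !big_nil !mul1r.
  rewrite !big_cons -!mulrA -IHs; elim: (m _) => [|k IHk].
    by rewrite !expr0 !mul1r.
  by rewrite !exprS -!mulrA -IHk wx_mulE.
by rewrite -[X in _ = _ * X]mulr1 dE xE -mpolyX_split.
Qed.

End WeylTheory.

Definition lspan {R : nzRingType} {V : lmodType R} (X : set V) : set V :=
  [set v | exists s : seq (R * V),
     (forall q, q \in s -> X q.2) /\ v = \sum_(q <- s) q.1 *: q.2].

(* The left ideal generated by X; the ideal, when S is commutative. *)
Definition lideal {S : nzRingType} (X : set S) : set S :=
  [set p | exists s : seq (S * S),
     (forall q, q \in s -> X q.2) /\ p = \sum_(q <- s) q.1 * q.2].

Section InitialIdeal.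
Variables (R : comNzRingType) (N : nat) (tau : 'rV[int]_(N + N)).

(* The first N entries of tau weigh the x_i, the last N ones the d_i. *)
Definition weight (m : 'X_{1..N + N}) : int :=
  \sum_(k < N + N) tau 0 k * (m k)%:Z.

Definition initial_form (l : weyl R N) : weyl R N :=
  \sum_(m <- msupp l | all (fun m' => weight m' <= weight m) (msupp l))
    l@_m *: ('X_[m] : {mpoly R[N + N]}).

(* Closed under left multiplication when tau (lshift N i) + tau (rshift N i)  *)
(* is nonnegative for all i.                                                  *)
Definition initial_ideal (I : set (weyl R N)) : set (weyl R N) :=
  lspan [set initial_form l | l in [set l | I l /\ l != 0]].

End InitialIdeal.

Definition mnm_col {N} (u : 'X_{1..N}) : 'cV[int]_N := \col_i (u i)%:Z.

Definition toric_ideal (R : comNzRingType) k N (B : 'M[int]_(k, N)) :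
    set {mpoly R[N]} :=
  lideal [set p | exists u v : 'X_{1..N},
    B *m mnm_col u = B *m mnm_col v /\ p = 'X_[u] - 'X_[v]].

(* In dimension n + 1, lshift 1 j indexes x_j and d_j, and rshift n ord0      *)
(* indexes t and d_t.                                                         *)
Section ModifiedHypergeometric.
Variables (R : comNzRingType) (d n : nat).
Variables (A : 'M[int]_(d, n)) (w : 'rV[int]_n) (beta : 'cV[R]_d).
Local Notation D := (weyl R (n + 1)).

Definition tau : 'rV[int]_((n + 1) + (n + 1)) :=
  row_mx (row_mx 0 (const_mx (-1))) (row_mx 0 (const_mx 1)).

Definition tildeA : 'M[int]_(d + 1, n + 1) := block_mx A 0 w 1%:M.

(* The inclusion of R[d_1, ..., d_n, t] into D. *)
Definition dt_embed : {mpoly R[n + 1]} -> D :=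
  mmap (in_alg D)
    (fun k => match split k with
              | inl j => wd (lshift 1 j)
              | inr j => wx (rshift n j)
              end).

Definition toric_ops : set D := dt_embed @` toric_ideal tildeA.

Definition euler_op (i : 'I_d) : D :=
  \sum_(j < n) (A i j)%:~R *: (wx (lshift 1 j) * wd (lshift 1 j))
  - (beta i 0)%:A.

Definition weight_euler_op : D :=
  \sum_(j < n) (w 0 j)%:~R *: (wx (lshift 1 j) * wd (lshift 1 j))
  - wx (rshift n ord0) * wd (rshift n ord0).

Definition euler_ops : set D := range euler_op `|` [set weight_euler_op].

Definition modified_hypergeometric_ideal : set D :=
  lideal (euler_ops `|` toric_ops).

End ModifiedHypergeometric.

Definition zariski_closed {R : comNzRingType} {d} (Z : set 'cV[R]_d) : Prop :=
  exists F : set {mpoly R[d]},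
    Z = [set b | forall f, F f -> f.@[fun i => b i 0] = 0].

(* Main.v *)
Require Import Defs.
From Stdlib Require List.
From HB Require Import structures.
From mathcomp Require Import all_boot all_order all_algebra.
From mathcomp Require Import boolp classical_sets complex reals.
From mathcomp Require Import mpoly.

Set Implicit Arguments.
Unset Strict Implicit.
Unset Printing Implicit Defensive.

Import Order.TTheory GRing.Theory Num.Theory.

Local Open Scope ring_scope.
Local Open Scope classical_set_scope.
Local Open Scope complex_scope.

(** Write [E_0, ..., E_d] for the Euler operators and [I] for the toric ideal.
    The Euler operators have weight 0, so the right-hand side lies in the initial
    ideal. For the other inclusion take [l = p + sum_i Q_i E_i] with [p] in [D I]
    and all of [p], [Q_i] of weight at most [e]. If the parts of weight [e] do
    not cancel, they exhibit the initial form of [l] as an element of the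
    right-hand side. If they cancel, the leading parts of the [Q_i] are a syzygy
    of the [E_i] modulo [J = in (D I)], and it has to be lifted to a syzygy modulo
    [D I], so that [e] can be lowered ([lower_representation]).

    Right multiplications by the [E_i] are commuting left linear endomorphisms
    of [D], and they preserve [D I] ([toric_mulr_euler]). Koszul syzygies
    therefore lift, and the theorem follows once the Koszul complex of these
    endomorphisms on [D / J] is exact in degree one.

    For generic [w] the left ideal [J] is generated by the monomials [d^u] such
    that [u] does not minimize [w] on its fiber [{v | A v = A u}]
    ([toric_initial]). The upper bound on [J] is seen after writing all [d_t] to
    the left of all [t] ([reorder]), where right multiplication by [d_j] and [t]
    becomes commutative: an element of [D I] then has vanishing coefficient sums
    over the classes of monomials congruent modulo [I].

    In normally ordered coordinates right multiplication by [x_k d_k] is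
    [rho k : X^m -> X^(m + x_k + d_k) + m_(d_k) X^m]. By Dickson's lemma the
    exponents of the derivations fall into finitely many cells, an exponent being
    either fixed or arbitrary above a common bound, and [J] is spanned by a union
    of cells that is closed upwards. Adding one cell at a time to [J] reduces
    exactness on [D / J] to exactness on one standard cell ([cell_koszul]). There
    [rho k] is a constant in the bounded directions. If the columns of [A] in the
    unbounded directions [S] do not have rank [d], some combination of the [E_i]
    is a scalar on the cell, nonzero for [beta] outside a hyperplane
    ([cell_koszul1]). If they have rank [d], they are also independent, as each
    fiber has at most one standard element; then the [E_i] are, up to an
    invertible matrix, the operators [rho k - lam k] for [k] in [S] or [k = t].
    These have left inverses commuting with the other ones ([lower]), which
    makes their Koszul complex exact ([koszul_exact], [cell_koszul2]). *)

(** * Linear operators on polynomials given by their values on monomials *)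

Section LinearExtension.
Variables (R : comNzRingType) (k : nat).
Local Notation P := {mpoly R[k]}.
Implicit Types (p q : P) (m : 'X_{1..k}) (S : pred 'X_{1..k}).

Lemma linear_mpoly_ext (V : lmodType R) (f g : {linear P -> V}) :
  (forall m, f 'X_[m] = g 'X_[m]) -> f =1 g.
Proof.
move=> fg p; rewrite [p]mpolyE !linear_sum; apply: eq_bigr => m _.
by rewrite !linearZ_LR fg.
Qed.

Definition lin_ext (V : lmodType R) (g : 'X_{1..k} -> V) p : V :=
  \sum_(m <- msupp p) p@_m *: g m.

Lemma lin_extwE (V : lmodType R) (g : 'X_{1..k} -> V) (s : seq 'X_{1..k}) p :
  uniq s -> {subset msupp p <= s} -> lin_ext g p = \sum_(m <- s) p@_m *: g m.
Proof.
move=> us sub; rewrite /lin_ext [RHS](bigID (mem (msupp p))) /=.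
rewrite [X in _ = _ + X]big1 ?addr0; last first.
  by move=> m /memN_msupp_eq0 ->; rewrite scale0r.
rewrite -[RHS]big_filter; apply: perm_big; apply: uniq_perm.
- exact: msupp_uniq.
- exact: filter_uniq.
by move=> m; rewrite mem_filter /=; case: (boolP (m \in msupp p)) => //= /sub ->.
Qed.

Lemma lin_ext_is_linear (V : lmodType R) (g : 'X_{1..k} -> V) :
  linear (lin_ext g).
Proof.
move=> c p r; pose s := undup (msupp p ++ msupp r ++ msupp (c *: p + r)).
have us : uniq s by exact: undup_uniq.
rewrite !(@lin_extwE V g s) // => [|m mr|m mp|m mpr]; last first.
- by rewrite mem_undup !mem_cat mpr !orbT.
- by rewrite mem_undup !mem_cat mp.
- by rewrite mem_undup !mem_cat mr !orbT.
rewrite scaler_sumr -big_split /=; apply: eq_bigr => m _.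
by rewrite mcoeffD mcoeffZ scalerDl scalerA.
Qed.

HB.instance Definition _ (V : lmodType R) (g : 'X_{1..k} -> V) :=
  GRing.isLinear.Build R P V *:%R (lin_ext g) (lin_ext_is_linear g).

Lemma lin_extX (V : lmodType R) (g : 'X_{1..k} -> V) m : lin_ext g 'X_[m] = g m.
Proof. by rewrite /lin_ext msuppX big_seq1 mcoeffX eqxx scale1r. Qed.

Definition supported S : {pred P} := fun p => all S (msupp p).

Lemma supportedP S p :
  reflect (forall m, p@_m != 0 -> S m) (p \in supported S).
Proof.
by apply: (iffP allP) => H m mp; apply: H; rewrite ?mcoeff_msupp // -mcoeff_msupp.
Qed.

Lemma supportedPn S p :
  (p \in supported S) <-> (forall m, ~~ S m -> p@_m = 0).
Proof.
split=> [/supportedP H m|H]; first by apply: contraNeq => /H.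
by apply/supportedP => m; apply: contraR => /H ->.
Qed.

Lemma supported_submod S : GRing.submod_closed (supported S).
Proof.
split; first by apply/supportedP => m; rewrite mcoeff0 eqxx.
move=> c p q /supportedPn Sp /supportedPn Sq; apply/supportedPn => m Sm.
by rewrite mcoeffD mcoeffZ Sp // Sq // mulr0 addr0.
Qed.

HB.instance Definition _ S :=
  GRing.isSubmodClosed.Build R P (supported S) (supported_submod S).

Lemma supportedX S m : ('X_[m] \in supported S) = S m.
Proof. by rewrite /supported unfold_in msuppX /= andbT. Qed.

Lemma sub_supported (S S' : pred 'X_{1..k}) p :
  (forall m, S m -> S' m) -> p \in supported S -> p \in supported S'.
Proof. by move=> SS' /supportedP H; apply/supportedP => m /H /SS'. Qed.

Definition proj S : P -> P := lin_ext (fun m => if S m then 'X_[m] else 0).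

HB.instance Definition _ S := GRing.Linear.copy (proj S) 
  (lin_ext (fun m => if S m then ('X_[m] : P) else 0)).

Lemma projX S m : proj S 'X_[m] = if S m then 'X_[m] else 0.
Proof. exact: lin_extX. Qed.

Lemma mcoeff_proj S p m : (proj S p)@_m = if S m then p@_m else 0.
Proof.
rewrite {1}[p]mpolyE (linear_sum (proj S)) linear_sum.
rewrite (eq_bigr (fun m' => if S m then p@_m' * (m' == m)%:R else 0)) => [|m' _].
  case: ifP => _; last by rewrite big1.
  rewrite [in RHS](mpolyE p) linear_sum; apply: eq_bigr => m' _.
  by rewrite /= mcoeffZ mcoeffX.
rewrite (linearZ_LR (proj S)) /= mcoeffZ projX; case: (eqVneq m' m) => [->|m'm].
  by case: ifP; rewrite ?mcoeffX ?eqxx // mcoeff0 mulr0.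
by case: ifP => _; rewrite ?mcoeffX ?(negbTE m'm) ?mcoeff0 mulr0; case: ifP.
Qed.

Lemma proj_supported S p : proj S p \in supported S.
Proof. by apply/supportedPn => m /negbTE Sm; rewrite mcoeff_proj Sm. Qed.

Lemma proj_id S p : p \in supported S -> proj S p = p.
Proof.
move=> /supportedPn Sp; apply/mpolyP => m; rewrite mcoeff_proj.
by case: ifPn => // /Sp.
Qed.

Lemma proj_in S S' p : p \in supported S' -> proj S p \in supported S'.
Proof.
by move=> /supportedPn Sp; apply/supportedPn => m /Sp; rewrite mcoeff_proj => ->; case: ifP.
Qed.

Lemma proj0 S p : p \in supported (fun m => ~~ S m) -> proj S p = 0.
Proof.
move=> /supportedPn Sp; apply/mpolyP => m; rewrite mcoeff_proj mcoeff0.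
by case: ifPn => // Sm; rewrite Sp // negbK.
Qed.

Lemma sub_proj_supported S p : p - proj S p \in supported (fun m => ~~ S m).
Proof.
by apply/supportedPn => m; rewrite negbK mcoeffB mcoeff_proj => ->; rewrite subrr.
Qed.

End LinearExtension.

Lemma linear_supported (R : comNzRingType) k k' (S : pred 'X_{1..k})
    (S' : pred 'X_{1..k'}) (f : {linear {mpoly R[k]} -> {mpoly R[k']}}) p :
    (forall m, S m -> f 'X_[m] \in supported S') ->
  p \in supported S -> f p \in supported S'.
Proof.
move=> fS /supportedP Sp; rewrite [p]mpolyE linear_sum rpred_sum // => m _.
rewrite linearZ_LR; have [-> | pm] := eqVneq p@_m 0; first by rewrite scale0r rpred0.
exact/rpredZ/fS/Sp.
Qed.

Lemma mulX_supported (R : comNzRingType) k (S S' : pred 'X_{1..k}) m'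
    (p : {mpoly R[k]}) :
    (forall m, S m -> S' (m' + m)%MM) ->
  p \in supported S -> 'X_[m'] * p \in supported S'.
Proof.
move=> SS' /supportedP Sp; rewrite [p]mpolyE mulr_sumr rpred_sum // => m _.
rewrite -scalerAr -mpolyXD; have [-> | pm] := eqVneq p@_m 0.
  by rewrite scale0r rpred0.
by rewrite rpredZ // supportedX SS' // Sp.
Qed.

(** * Right multiplication in the Weyl algebra, on normally ordered polynomials *)

Section RightMultiplication.
Variables (R : comNzRingType) (N : nat).
Local Notation P := {mpoly R[N + N]}.
Local Notation W := (weyl R N).
Local Notation xi k := (lshift N k).
Local Notation di k := (rshift N k).
Implicit Types (p q : P) (m : 'X_{1..N + N}) (k i : 'I_N).

(** The operators are built from 1 by left multiplications; this proves formulas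
    for right multiplications, which commute with left ones. *)
Lemma weyl_ind (K : W -> Prop) :
    K 1 -> (forall p q, K p -> K q -> K (p + q)) -> (forall c p, K p -> K (c *: p)) ->
    (forall i p, K p -> K (wx i * p)) -> (forall i p, K p -> K (wd i * p)) ->
  forall p, K p.
Proof.
move=> K1 KD KZ Kx Kd p; rewrite [p]mpolyE; elim: (msupp p) => [|m s IHs].
  by rewrite big_nil; have := KZ 0 1 K1; rewrite scale0r.
rewrite big_cons; apply: (KD _ _ _ IHs); apply: KZ.
rewrite (weyl_monomialE _ m).
move: (index_enum _) {1}(index_enum _) => s2 s1; elim: s1 => [|i s1 IHs1].
  rewrite big_nil mul1r; elim: s2 => [|i s2 IHs2]; first by rewrite big_nil.
  rewrite big_cons; elim: (m _) => [|e IHe]; first by rewrite mul1r.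
  by rewrite exprS -mulrA; apply: Kd.
rewrite big_cons; elim: (m _) => [|e IHe]; first by rewrite mul1r.
by rewrite exprS -!mulrA; apply: Kx; rewrite !mulrA in IHe *.
Qed.

Lemma weyl_mulr_x k (p : W) : 
  p * wx k = ('X_(xi k) : P) * (p : P) + (p : P)^`M(di k) :> P.
Proof.
elim/weyl_ind: p => [|p q IHp IHq|c p IHp|i p IHp|i p IHp].
- rewrite mul1r -[LHS]/('X_(xi k) : P) -[X in _ + X]/((1 : P)^`M(di k)).
  by rewrite -[_ * _]/('X_(xi k) * (1 : P)) mulr1 -mpolyC1 mderivC addr0.
- by rewrite mulrDl; apply: (etrans (congr2 +%R IHp IHq)); rewrite mderivD mulrDr addrACA.
- rewrite -scalerAl; apply: (etrans (congr1 ( *:%R c) IHp)).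
  by rewrite mderivZ scalerDr scalerAr.
- rewrite -mulrA wx_mulE IHp wx_mulE mulrDr mderivM mderivXX eq_rlshift mul0r add0r.
  by rewrite mulrCA.
rewrite -mulrA wd_mulE IHp wd_mulE (linearD (dmul i)) /= dmulX !dmulE mderivD mderivM mderivXX.
by rewrite eq_rshift (mderiv_comm (di k)) (eq_sym k i) -!addrA.
Qed.

Lemma weyl_mulr_d k (p : W) : p * wd k = ('X_(di k) : P) * (p : P) :> P.
Proof.
elim/weyl_ind: p => [|p q IHp IHq|c p IHp|i p IHp|i p IHp].
- by rewrite mul1r -[RHS]/('X_(di k) * (1 : P)) mulr1.
- by rewrite mulrDl; apply: (etrans (congr2 +%R IHp IHq)); rewrite mulrDr.
- rewrite -scalerAl; apply: (etrans (congr1 ( *:%R c) IHp)).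
  by rewrite scalerAr.
- by rewrite -mulrA wx_mulE IHp wx_mulE mulrCA.
rewrite -mulrA wd_mulE IHp wd_mulE !dmulE mderivM mderivXX eq_lrshift mul0r add0r.
by rewrite mulrDr mulrCA.
Qed.

Definition diag_mnm k : 'X_{1..N + N} := (U_(xi k) + U_(di k))%MM.

(** Right multiplication by the Euler operator [x_k d_k]. *)
Definition rho k : P -> P :=
  lin_ext (fun m => 'X_[diag_mnm k + m] + (m (di k))%:R *: 'X_[m]).

HB.instance Definition _ k := GRing.Linear.copy (rho k)
  (lin_ext (fun m => ('X_[diag_mnm k + m] + (m (di k))%:R *: 'X_[m] : P))).

Lemma rhoX k m : rho k 'X_[m] = 'X_[diag_mnm k + m] + (m (di k))%:R *: 'X_[m].
Proof. exact: lin_extX. Qed.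

Lemma weyl_mulr_xd k (p : W) : p * (wx k * wd k) = rho k p :> P.
Proof.
rewrite mulrA weyl_mulr_d weyl_mulr_x mulrDr mulrA.
pose f q := 'X_(di k) * 'X_(xi k) * q + 'X_(di k) * q^`M(di k).
have flin : linear f.
  move=> c q r; rewrite /f mderivD mderivZ !mulrDr !scalerDr !scalerAr.
  by rewrite addrACA.
pose F : {linear P -> P} := HB.pack f (GRing.isLinear.Build R P P *:%R f flin).
rewrite -[LHS]/(F p); apply: linear_mpoly_ext => m /=.
rewrite /f rhoX /diag_mnm [(U_(xi k) + _)%MM]addmC !mpolyXD mderivX -scalerAr.
have [-> | mk] := eqVneq (m (di k)) 0; first by rewrite !scale0r.
by congr (_ + _ *: _); rewrite -mpolyXD addmC submK // lep1mP.
Qed.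

Lemma rhoC k l p : rho k (rho l p) = rho l (rho k p).
Proof.
apply: (linear_mpoly_ext (f := rho k \o rho l) (g := rho l \o rho k)) => m /=.
rewrite !rhoX !linearD !linearZ_LR /= !rhoX !scalerDr.
rewrite addmA [(diag_mnm k + diag_mnm l)%MM]addmC -addmA !addrA; case: (eqVneq k l) => [-> //|kl].
rewrite !mnmDE !mnm1E !eq_lrshift !eq_rshift (negbTE kl) eq_sym (negbTE kl) !add0n.
by rewrite (scalerA _ (m (di l))%:R) (scalerA _ (m (di k))%:R) [_ * (m (di l))%:R]mulrC -!addrA; congr (_ + _); rewrite addrCA.
Qed.

End RightMultiplication.

(** * Exactness of Koszul complexes in degree one *)

(** Induction on [s]: applying [T a] to the relation solves for [z a] as a
    combination of the remaining [f l], since [T a] commutes with them, and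
    subtracting the corresponding Koszul relations removes [a] from the
    relation. *)
Lemma koszul_exact (R : nzRingType) (V : lmodType R) (I : eqType)
    (U : zmodClosed V) (f T : I -> {linear V -> V}) (s : seq I) (z : I -> V) :
    uniq s ->
    (forall k v, k \in s -> v \in U -> f k v \in U) ->
    (forall k v, k \in s -> v \in U -> T k v \in U) ->
    (forall k v, k \in s -> v \in U -> T k (f k v) = v) ->
    (forall k l v, k \in s -> l \in s -> k != l -> v \in U ->
       T k (f l v) = f l (T k v)) ->
    (forall k l v, f k (f l v) = f l (f k v)) ->
    (forall k, k \in s -> z k \in U) -> \sum_(k <- s) f k (z k) = 0 ->
  exists r : I -> I -> V,
    [/\ forall k l, r k l \in U, forall k l, r l k = - r k l &
        forall k, k \in s -> z k = \sum_(l <- s) f l (r k l)].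
Proof.
elim: s z => [|a s IHs] z.
  by exists (fun _ _ => 0); split=> // *; rewrite ?rpred0 ?oppr0.
move=> /= /andP[as_ us] fU TU Tf Tcf fC zU.
have sub k : k \in s -> k \in a :: s by rewrite inE orbC => ->.
have aa : a \in a :: s by rewrite inE eqxx.
have na k : k \in s -> a != k by move=> ks; apply: contraNneq as_ => ->.
rewrite big_cons => fz0; pose c l := if l \in s then - T a (z l) else 0.
have cU l : c l \in U.
  by rewrite /c; case: ifP => ls; rewrite ?rpred0 // rpredN; apply/TU/zU/sub.
have za : z a = \sum_(l <- s) f l (c l).
  rewrite -(Tf a _ aa (zU _ aa)) (_ : f a (z a) = - \sum_(l <- s) f l (z l)).
    rewrite linearN linear_sum -sumrN big_seq [RHS]big_seq; apply: eq_bigr => l ls.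
    by rewrite (Tcf _ _ _ aa (sub _ ls) (na _ ls) (zU _ (sub _ ls))) /c ls linearN.
  by apply/eqP; rewrite -addr_eq0 fz0.
have [|k v ks|k v ks|k l v ks ls||||r [rU ranti zr]] := IHs (fun l => z l + f a (c l)) us.
- by move=> k v ks; apply/fU/sub.
- by apply/TU/sub.
- by apply/Tf/sub.
- by apply: Tcf; apply: sub.
- exact: fC.
- by move=> k ks; rewrite rpredD //; [apply/zU/sub|apply: fU].
- rewrite -[RHS]fz0 za linear_sum -big_split; apply: eq_bigr => l _ /=.
  by rewrite linearD addrC fC.
exists (fun k l => if k == a then if l == a then 0 else c l
                   else if l == a then - c k else r k l); split=> [k l|k l|k].
- by case: ifP; case: ifP => *; rewrite ?rpred0 ?rpredN.
- by case: ifP; case: ifP => *; rewrite ?oppr0 ?opprK.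
rewrite inE big_cons eqxx; case: (eqVneq k a) => [-> _|ka /= ks].
  rewrite linear0 add0r za [LHS]big_seq [RHS]big_seq; apply: eq_bigr => l ls.
  by rewrite eq_sym (negbTE (na _ ls)).
rewrite linearN; apply/eqP; rewrite addrC eq_sym subr_eq eq_sym; apply/eqP.
rewrite zr // [LHS]big_seq [RHS]big_seq; apply: eq_bigr => l ls.
by rewrite eq_sym (negbTE (na _ ls)).
Qed.

(** * Generic Euler operators on a quotient by a monomial ideal *)

Section Cells.
Variables (K : fieldType) (N : nat).
Local Notation P := {mpoly K[N + N]}.
Local Notation xi k := (lshift N k).
Local Notation di k := (rshift N k).
Implicit Types (p q : P) (m : 'X_{1..N + N}) (k l : 'I_N) (c : nat) (lam : K).

Definition shifted_rho lam k : P -> P := fun p => rho k p - lam *: p.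

Lemma shifted_rho_is_linear lam k : linear (shifted_rho lam k).
Proof.
move=> a p q; rewrite /shifted_rho linearP scalerBr !scalerDr opprD addrACA.
by rewrite !scalerA mulrC.
Qed.

HB.instance Definition _ lam k :=
  GRing.isLinear.Build K P P *:%R (shifted_rho lam k) (shifted_rho_is_linear lam k).

Lemma shifted_rhoX lam k m :
  shifted_rho lam k 'X_[m] =
  'X_[diag_mnm k + m] + ((m (di k))%:R - lam) *: 'X_[m].
Proof. by rewrite /shifted_rho rhoX scalerBl addrA. Qed.

Lemma shifted_rhoC lam lam' k l p :
  shifted_rho lam k (shifted_rho lam' l p) =
  shifted_rho lam' l (shifted_rho lam k p).
Proof.
rewrite /shifted_rho (linearB (rho k)) (linearB (rho l)) (linearZ_LR (rho k)).
rewrite (linearZ_LR (rho l)) /= (rhoC k l) !scalerBr !scalerA (mulrC lam').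
by rewrite !opprD !opprK addrACA.
Qed.

Lemma diag_mnmE k l :
  (diag_mnm k (xi l) = (k == l)) * (diag_mnm k (di l) = (k == l)).
Proof.
rewrite /diag_mnm !mnmDE !mnm1E.
by rewrite eq_lshift eq_rlshift eq_lrshift eq_rshift addn0 add0n.
Qed.

(** On monomials whose exponent of [d_k] is at least [c], [lower_rec] is a left
    inverse of [shifted_rho lam k], obtained by solving
    [X^(m + x_k + d_k) = shifted_rho lam k X^m - (m_(d_k) - lam) X^m]
    recursively. The counter [j] is the exponent of [x_k], which drops at each
    step. *)
Fixpoint lower_rec c lam k j m : P :=
  if j is j'.+1 then
    if (c < m (di k))%N then
      'X_[m - diag_mnm k] -
      (((m - diag_mnm k)%MM (di k))%:R - lam) *: lower_rec c lam k j' (m - diag_mnm k)%MM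
    else 0
  else 0.

Definition lower c lam k : P -> P :=
  lin_ext (fun m => lower_rec c lam k (m (xi k)) m).

HB.instance Definition _ c lam k := GRing.Linear.copy (lower c lam k)
  (lin_ext (fun m => lower_rec c lam k (m (xi k)) m)).

Lemma lowerX c lam k m : lower c lam k 'X_[m] = lower_rec c lam k (m (xi k)) m.
Proof. exact: lin_extX. Qed.

Lemma lower_shifted_rho c lam k p :
    p \in supported (fun m => c <= m (di k))%N ->
  lower c lam k (shifted_rho lam k p) = p.
Proof.
move=> /supportedP Sp; rewrite {1}[p]mpolyE linear_sum linear_sum [RHS]mpolyE.
rewrite big_seq [RHS]big_seq; apply: eq_bigr => m; rewrite mcoeff_msupp => /Sp cm.
rewrite !linearZ_LR /=; congr (_ *: _).
rewrite shifted_rhoX linearD linearZ_LR /= !lowerX mnmDE !diag_mnmE eqxx add1n /=.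
rewrite mnmDE !diag_mnmE eqxx add1n ltnS cm addmC addmK.
by rewrite subrK.
Qed.

Lemma lower_rec_in c lam k j (S : pred 'X_{1..N + N}) m :
    (forall m', S m' -> (c < m' (di k))%N -> (0 < m' (xi k))%N -> S (m' - diag_mnm k)%MM) ->
    (j <= m (xi k))%N -> S m -> lower_rec c lam k j m \in supported S.
Proof.
move=> SB; elim: j m => [|j IHj] m /= jm Sm; first by rewrite rpred0.
case: ifP => cm; last by rewrite rpred0.
have Sm' : S (m - diag_mnm k)%MM by apply: SB => //; exact: leq_ltn_trans jm.
rewrite rpredB ?supportedX // rpredZ // IHj // mnmBE diag_mnmE eqxx.
by rewrite leq_subRL ?add1n //; apply: leq_ltn_trans jm.
Qed.

Lemma lower_in c lam k (S : pred 'X_{1..N + N}) p :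
    (forall m', S m' -> (c < m' (di k))%N -> (0 < m' (xi k))%N -> S (m' - diag_mnm k)%MM) ->
    p \in supported S -> lower c lam k p \in supported S.
Proof.
move=> SB; apply: linear_supported => m Sm /=; rewrite lowerX.
exact: lower_rec_in.
Qed.

(** The recursion of [lower_rec] only inspects the exponents of [x_k] and [d_k],
    which [shifted_rho lam' l] does not change for [l != k]. *)
Lemma lower_recC c lam lam' k l j m : k != l -> (j <= m (xi k))%N ->
  lower_rec c lam k j (diag_mnm l + m) +
    ((m (di l))%:R - lam') *: lower_rec c lam k j m =
  shifted_rho lam' l (lower_rec c lam k j m).
Proof.
move=> kl; have /negbTE lk : l != k by rewrite eq_sym.
elim: j m => [|j IHj] m /= jm; first by rewrite scaler0 linear0 addr0.
rewrite mnmDE !diag_mnmE lk add0n; case: ifP => cm; last first.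
  by rewrite scaler0 linear0 addr0.
have km : (diag_mnm k <= m)%MM.
  apply/mnm_lepP => i; case: (split_ordP i) => i' ->; rewrite diag_mnmE.
    by case: eqP => // <-; apply: leq_trans jm.
  by case: eqP => // <-; apply: leq_trans cm.
have -> : (diag_mnm l + m - diag_mnm k = diag_mnm l + (m - diag_mnm k))%MM.
  by rewrite -{1}(submK km) addmA addmK.
have jm' : (j <= (m - diag_mnm k)%MM (xi k))%N.
  by rewrite mnmBE diag_mnmE eqxx leq_subRL ?add1n //; apply: leq_trans jm.
have <- : (m - diag_mnm k)%MM (di l) = m (di l).
  by rewrite mnmBE diag_mnmE (negbTE kl) subn0.
move: (m - diag_mnm k)%MM jm' => m' jm'.
rewrite mnmDE diag_mnmE lk add0n (linearB (shifted_rho lam' l)).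
rewrite (linearZ_LR (shifted_rho lam' l)) /= -IHj // shifted_rhoX.
rewrite scalerBr scalerDr !scalerA opprD addrACA.
by rewrite [in X in _ + X]mulrC.
Qed.

Lemma lowerC c lam lam' k l p : k != l ->
  lower c lam k (shifted_rho lam' l p) = shifted_rho lam' l (lower c lam k p).
Proof.
move=> kl; apply: (linear_mpoly_ext (f := lower c lam k \o shifted_rho lam' l)
  (g := shifted_rho lam' l \o lower c lam k)) => m /=.
rewrite shifted_rhoX linearD linearZ_LR /= !lowerX mnmDE !diag_mnmE.
by rewrite eq_sym (negbTE kl) add0n; apply: lower_recC.
Qed.

End Cells.

Section GenericEuler.
Variables (K : numFieldType) (N b r : nat) (bnd : 'I_N -> 'I_b.+1).
Variables (B : 'M[K]_(r, N)) (gam : 'I_r -> K).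
Local Notation P := {mpoly K[N + N]}.
Local Notation xi k := (lshift N k).
Local Notation di k := (rshift N k).
Local Notation cellT := {ffun 'I_N -> 'I_b.+1}.
Implicit Types (p : P) (m : 'X_{1..N + N}) (k l : 'I_N) (i j : 'I_r).
Implicit Types (c : cellT) (C : {set cellT}).

Definition cell m : cellT := [ffun k => inord (minn (m (di k)) (bnd k))].

Lemma cellE m k : cell m k = minn (m (di k)) (bnd k) :> nat.
Proof.
rewrite ffunE inordK // ltnS; apply: leq_trans (geq_minr _ _) _.
by rewrite -ltnS.
Qed.

Lemma cell_diag k m : (bnd k <= m (di k))%N -> cell (diag_mnm k + m) = cell m.
Proof.
move=> km; apply/ffunP => l; apply: val_inj; rewrite /= !cellE mnmDE diag_mnmE.
case: eqVneq => [<-|//]; rewrite !(minn_idPr _) //.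
exact: leq_trans (leq_addl _ _).
Qed.

Lemma cell_diagB k m : (bnd k < m (di k))%N -> cell (m - diag_mnm k) = cell m.
Proof.
move=> km; apply/ffunP => l; apply: val_inj; rewrite /= !cellE mnmBE diag_mnmE.
case: eqVneq => [<-|]; last by rewrite subn0.
rewrite !(minn_idPr _) //; first exact: ltnW.
by rewrite leq_subRL ?add1n //; apply: leq_trans km.
Qed.

Lemma cell_diag_sum k m : (m (di k) < bnd k)%N ->
  (\sum_l cell m l < \sum_l cell (diag_mnm k + m) l)%N.
Proof.
move=> km; rewrite (bigD1 k) //= [X in (_ < X)%N](bigD1 k) //= -addSn.
apply: leq_add; last first.
  by apply: leq_sum => l _; rewrite !cellE mnmDE leq_min !geq_minr /= geq_min leq_addl.
rewrite !cellE mnmDE diag_mnmE eqxx add1n (minn_idPl (ltnW km)).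
by rewrite (minn_idPl km).
Qed.

Definition upclosed C := forall k m, cell m \in C -> cell (diag_mnm k + m) \in C.

Definition cell_span C : {pred P} := supported (fun m => cell m \in C).

Definition euler i : P -> P := fun p => \sum_k B i k *: rho k p - gam i *: p.

Lemma euler_is_linear i : linear (euler i).
Proof.
move=> a p q; rewrite /euler scalerBr scaler_sumr.
rewrite (eq_bigr (fun k => a *: (B i k *: rho k p) + B i k *: rho k q)) => [|k _].
  by rewrite big_split /= scalerDr opprD addrACA !scalerA (mulrC a).
by rewrite linearP scalerDr !scalerA (mulrC a).
Qed.

HB.instance Definition _ i :=
  GRing.isLinear.Build K P P *:%R (euler i) (euler_is_linear i).

Lemma rho_supported k (S : pred 'X_{1..N + N}) p :
    (forall m, S m -> S (diag_mnm k + m)%MM) ->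
  p \in supported S -> rho k p \in supported S.
Proof.
move=> SS; apply: linear_supported => m Sm /=.
by rewrite rhoX rpredD ?rpredZ ?supportedX ?SS.
Qed.

Lemma euler_supported i (S : pred 'X_{1..N + N}) p :
    (forall k m, S m -> S (diag_mnm k + m)%MM) ->
  p \in supported S -> euler i p \in supported S.
Proof.
move=> SS Sp; rewrite rpredB ?rpredZ // rpred_sum // => k _.
by rewrite rpredZ // rho_supported // => m; apply: SS.
Qed.

Lemma eulerC i j p : euler i (euler j p) = euler j (euler i p).
Proof.
have comm k : rho k (euler i p) = euler i (rho k p).
  rewrite /euler linearB linear_sum linearZ_LR; congr (_ - _).
  by apply: eq_bigr => l _; rewrite linearZ_LR /= rhoC.
rewrite -[RHS]/(\sum_k B j k *: rho k (euler i p) - gam j *: euler i p).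
rewrite -[X in euler i X]/(\sum_k B j k *: rho k p - gam j *: p).
rewrite (linearB (euler i)) (linear_sum (euler i)) (linearZ_LR (euler i)).
congr (_ - _); apply: eq_bigr => l _.
by rewrite (linearZ_LR (euler i)) comm.
Qed.

(** The operators commute, so the double sum equals its own opposite. *)
Lemma sum_euler_antisym (q : 'I_r -> 'I_r -> P) :
    (forall i j, q j i = - q i j) ->
  \sum_i euler i (\sum_j euler j (q i j)) = 0.
Proof.
move=> qanti; have : \sum_i euler i (\sum_j euler j (q i j)) =
    - \sum_i euler i (\sum_j euler j (q i j)).
  under eq_bigr => i _ do rewrite (linear_sum (euler i)).
  rewrite [LHS]exchange_big -sumrN; apply: eq_bigr => i _; rewrite -sumrN.
  apply: eq_bigr => j _ /=.
  by rewrite qanti eulerC (linearN (euler j)) (linearN (euler i)).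
move/eqP; rewrite -addr_eq0 -mulr2n -scaler_nat scaler_eq0 pnatr_eq0 /=.
by move/eqP.
Qed.

(** On the monomials of a cell [c] the operator [rho k] multiplies by the
    constant [c k], modulo higher cells, unless the cell is unbounded in the
    direction [k]. *)
Definition cell_const c i : K :=
  \sum_(k | c k != bnd k) B i k * (c k)%:R - gam i.

(** Raising a bounded exponent leaves the cell, hence lands in [C]. *)
Lemma euler_cell c C i p :
    c \notin C -> (forall k m, cell m = c -> c k != bnd k -> cell (diag_mnm k + m) \in C) ->
    p \in cell_span [set c] ->
  euler i p - (\sum_(k | c k == bnd k) B i k *: rho k p + cell_const c i *: p)
    \in cell_span C.
Proof.
move=> cC cup pc.
have -> : euler i p - (\sum_(k | c k == bnd k) B i k *: rho k p + cell_const c i *: p)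
    = \sum_(k | c k != bnd k) B i k *: (rho k p - (c k)%:R *: p).
  have cancel (u v g t : P) : (u + v - g) - (u + (t - g)) = v - t.
    by rewrite -(addrA u) opprD addrACA subrr add0r opprB addrA subrK.
  rewrite /euler /cell_const (bigID (fun k => c k == bnd k)) /= scalerBl cancel.
  rewrite scaler_suml -sumrB.
  by apply: eq_bigr => k _; rewrite scalerBr scalerA.
apply: rpred_sum => k ck; apply: rpredZ.
apply: (linear_supported (f := shifted_rho (c k)%:R k)) pc => m; rewrite inE => /eqP mc /=.
rewrite shifted_rhoX rpredD ?supportedX ?cup //.
suff -> : m (di k) = c k by rewrite subrr scale0r rpred0.
move: ck; rewrite -mc -val_eqE /= !cellE; case: leqP => [/minn_idPl|]; last by rewrite eqxx.
by [].
Qed.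

(** The two ways in which the Euler operators can be exact on a cell: either a
    combination of them is an invertible scalar there, or they are, up to an
    invertible change of basis, the operators [rho k - lam k] for the unbounded
    directions [k] of the cell. *)
Definition cell_exact c : Prop :=
  (exists y : 'I_r -> K,
     (forall k, c k = bnd k -> \sum_i y i * B i k = 0) /\
     \sum_i y i * cell_const c i != 0) \/
  (exists G : 'M[K]_(N, r),
     (forall i j, \sum_(k | c k == bnd k) B i k * G k j = (i == j)%:R) /\
     (forall k l, c k = bnd k -> c l = bnd l -> \sum_i G k i * B i l = (k == l)%:R)).

(** If a combination [sum_i y_i E_i] is a unit [s], a cycle [u] is the boundary of
    [s^-1 (y_j u_i - y_i u_j)]. *)
Lemma cell_koszul1 c C (y : 'I_r -> K) (u : 'I_r -> P) :
    c \notin C -> upclosed C ->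
    (forall k m, cell m = c -> c k != bnd k -> cell (diag_mnm k + m) \in C) ->
    (forall k, c k = bnd k -> \sum_i y i * B i k = 0) ->
    \sum_i y i * cell_const c i != 0 ->
    (forall i, u i \in cell_span [set c]) -> \sum_i euler i (u i) \in cell_span C ->
  exists q : 'I_r -> 'I_r -> P,
    [/\ forall i j, q i j \in cell_span [set c], forall i j, q j i = - q i j &
        forall i, u i - \sum_j euler j (q i j) \in cell_span C].
Proof.
move=> cC uC cup y0; set s := \sum_i _ => s0 uc uE.
exists (fun i j => s^-1 *: (y j *: u i - y i *: u j)); split=> [i j|i j|i].
- by rewrite rpredZ // rpredB ?rpredZ.
- by rewrite -[RHS]scalerN opprB.
have yE p : p \in cell_span [set c] ->
    \sum_j y j *: euler j p - s *: p \in cell_span C.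
  move=> pc; rewrite scaler_suml -sumrB.
  have -> : \sum_j (y j *: euler j p - (y j * cell_const c j) *: p) =
      \sum_j y j *: (euler j p -
        (\sum_(k | c k == bnd k) B j k *: rho k p + cell_const c j *: p)).
    under [RHS]eq_bigr do rewrite opprD addrA addrAC scalerBr.
    rewrite [RHS]sumrB [X in _ = _ - X](_ : _ = 0) ?subr0; last first.
      under eq_bigr do rewrite scaler_sumr.
      rewrite exchange_big big1 // => k /eqP ck /=.
      under eq_bigr do rewrite scalerA.
      by rewrite -scaler_suml y0 ?scale0r.
    by apply: eq_bigr => j _; rewrite [RHS]scalerBr scalerA.
  by apply: rpred_sum => j _; rewrite rpredZ ?euler_cell.
have -> : u i - \sum_j euler j (s^-1 *: (y j *: u i - y i *: u j)) =
    s^-1 *: (y i *: \sum_j euler j (u j) - (\sum_j y j *: euler j (u i) - s *: u i)).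
  rewrite (eq_bigr (fun j => s^-1 *: (y j *: euler j (u i) - y i *: euler j (u j)))).
    rewrite -scaler_sumr sumrB -(scaler_sumr (y i)).
    move: (\sum_j y j *: _) (\sum_j euler _ _) => v v'.
    rewrite [in RHS]opprB addrCA [RHS]scalerDr scalerA mulVf // scale1r.
    by congr (_ + _); rewrite -scalerN opprB.
  move=> j _; rewrite (linearZ_LR (euler j)) (linearB (euler j)).
  by rewrite !(linearZ_LR (euler j)).
by rewrite rpredZ // rpredB ?rpredZ ?yE.
Qed.

(** The cycle is transported along the change of basis [G] to the operators
    [rho k - lam k], which preserve the span of the cell exactly and not only
    modulo [C], and [koszul_exact] applies there. *)
Lemma cell_koszul2 c C (G : 'M[K]_(N, r)) (u : 'I_r -> P) :
    c \notin C -> upclosed C ->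
    (forall k m, cell m = c -> c k != bnd k -> cell (diag_mnm k + m) \in C) ->
    (forall i j, \sum_(k | c k == bnd k) B i k * G k j = (i == j)%:R) ->
    (forall k l, c k = bnd k -> c l = bnd l -> \sum_i G k i * B i l = (k == l)%:R) ->
    (forall i, u i \in cell_span [set c]) -> \sum_i euler i (u i) \in cell_span C ->
  exists q : 'I_r -> 'I_r -> P,
    [/\ forall i j, q i j \in cell_span [set c], forall i j, q j i = - q i j &
        forall i, u i - \sum_j euler j (q i j) \in cell_span C].
Proof.
move=> cC uC cup BG GB uc uE.
pose lam k := - \sum_j G k j * cell_const c j.
pose f k := shifted_rho (lam k) k.
have cellc m : (cell m \in [set c]%SET) = (cell m == c) by rewrite inE.
have bndc m k : cell m == c -> c k == bnd k -> (bnd k <= m (di k))%N.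
  by move=> /eqP <-; rewrite -val_eqE /= cellE => /eqP/minn_idPr.
have fc k p : c k == bnd k -> p \in cell_span [set c] -> f k p \in cell_span [set c].
  move=> ck; apply: linear_supported => m; rewrite cellc => mc /=.
  rewrite /f shifted_rhoX rpredD ?rpredZ // supportedX cellc //.
  by rewrite cell_diag // (bndc _ _ mc).
have Ef i p : p \in cell_span [set c] ->
    euler i p - \sum_(k | c k == bnd k) B i k *: f k p \in cell_span C.
  move=> pc; suff -> : \sum_(k | c k == bnd k) B i k *: f k p =
      \sum_(k | c k == bnd k) B i k *: rho k p + cell_const c i *: p.
    exact: euler_cell.
  rewrite /f /shifted_rho; under eq_bigr do rewrite scalerBr scalerA.
  rewrite sumrB -scaler_suml; congr (_ + _); rewrite -scaleNr; congr (_ *: _).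
  rewrite /lam; under eq_bigr do rewrite mulrN mulr_sumr.
  rewrite sumrN opprK exchange_big /= (bigD1 i) //= [X in _ + X]big1 ?addr0.
    under eq_bigr do rewrite mulrA.
    by rewrite -mulr_suml BG eqxx mul1r.
  move=> j ji; under eq_bigr do rewrite mulrA.
  by rewrite -mulr_suml BG eq_sym (negbTE ji) mul0r.
pose z k := \sum_i B i k *: u i.
have zc k : z k \in cell_span [set c] by apply: rpred_sum => i _; apply: rpredZ.
pose s := enum [pred k | c k == bnd k].
have sE k : (k \in s) = (c k == bnd k) by rewrite mem_enum inE.
have fzE : \sum_(k <- s) f k (z k) =
    \sum_i \sum_(k | c k == bnd k) B i k *: f k (u i).
  rewrite big_enum exchange_big /=; apply: eq_bigr => k _.
  rewrite /f /z (linear_sum (shifted_rho (lam k) k)); apply: eq_bigr => i _.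
  by rewrite (linearZ_LR (shifted_rho (lam k) k)).
have fz0 : \sum_(k <- s) f k (z k) = 0.
  have zC : \sum_(k <- s) f k (z k) \in cell_span C.
    have : \sum_i euler i (u i) - \sum_(k <- s) f k (z k) \in cell_span C.
      by rewrite fzE -sumrB; apply: rpred_sum => i _; apply: Ef.
    by move=> /(rpredB uE); rewrite opprB addrC subrK.
  have zc' : \sum_(k <- s) f k (z k) \in cell_span [set c].
    by rewrite big_seq; apply: rpred_sum => k; rewrite sE => ck; apply: fc.
  apply/mpolyP => m; rewrite mcoeff0; apply: contraTeq isT => mz; apply/negP => _.
  move/supportedP/(_ m mz): zc'; rewrite inE => /eqP mc.
  by move/supportedP/(_ m mz): zC; rewrite mc (negbTE cC).
have TU k v : k \in s -> v \in cell_span [set c] ->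
    lower (bnd k) (lam k) k v \in cell_span [set c].
  move=> _; apply: lower_in => m; rewrite !cellc => /eqP mc mk _.
  by rewrite cell_diagB // mc.
have Tf k v : k \in s -> v \in cell_span [set c] ->
    lower (bnd k) (lam k) k (f k v) = v.
  rewrite sE => ck vc; apply: lower_shifted_rho; apply: sub_supported vc => m.
  by rewrite cellc => mc; apply: bndc ck.
have [||||k l v _ _ kl _|k l v|k _|q [qc qanti zq]] :=
   @koszul_exact K _ _ (cell_span [set c]) (fun k => f k)
     (fun k => lower (bnd k) (lam k) k) s z _ _ _ _ _ _ _ fz0.
- exact: enum_uniq.
- by move=> k v; rewrite sE; apply: fc.
- exact: TU.
- exact: Tf.
- exact: lowerC.
- exact: shifted_rhoC.
- exact: zc.
have Gf l p : c l == bnd l -> p \in cell_span [set c] ->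
    \sum_j G l j *: euler j p - f l p \in cell_span C.
  move=> cl pc; suff -> : f l p = 
      \sum_j G l j *: \sum_(k | c k == bnd k) B j k *: f k p.
    rewrite -sumrB; apply: rpred_sum => j _.
    by rewrite -scalerBr; apply/rpredZ/Ef.
  under eq_bigr do rewrite scaler_sumr.
  rewrite exchange_big (bigD1 l) //= [X in _ + X]big1 ?addr0.
    by under eq_bigr do rewrite scalerA; rewrite -scaler_suml GB ?eqxx ?scale1r //; apply/eqP.
  move=> k /andP[/eqP ck kl]; under eq_bigr do rewrite scalerA.
  by rewrite -scaler_suml GB ?(eqP cl) // eq_sym (negbTE kl) scale0r.
exists (fun i j => \sum_(k | c k == bnd k) \sum_(l | c l == bnd l)
  (G k i * G l j) *: q k l); split=> [i j|i j|i].
- by apply: rpred_sum => k _; apply: rpred_sum => l _; apply: rpredZ.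
- rewrite exchange_big -sumrN; apply: eq_bigr => k _; rewrite -sumrN.
  by apply: eq_bigr => l _ /=; rewrite qanti scalerN mulrC.
have {1}-> : u i = \sum_(k | c k == bnd k) G k i *: \sum_(l | c l == bnd l) f l (q k l).
  transitivity (\sum_(k | c k == bnd k) G k i *: z k).
    rewrite /z; under eq_bigr do rewrite scaler_sumr.
    rewrite exchange_big (bigD1 i) //= [X in _ + X]big1 ?addr0.
      under eq_bigr do rewrite scalerA mulrC.
      by rewrite -scaler_suml BG eqxx scale1r.
    move=> j ji; under eq_bigr do rewrite scalerA mulrC.
    by rewrite -scaler_suml BG (negbTE ji) scale0r.
  by apply: eq_bigr => k ck; rewrite zq ?sE // big_enum.
rewrite -rpredN opprB.
rewrite [X in X - _](_ : _ = \sum_(k | c k == bnd k) G k i *: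
     \sum_(l | c l == bnd l) \sum_j G l j *: euler j (q k l)).
  rewrite -sumrB; apply: rpred_sum => k _; rewrite -scalerBr; apply: rpredZ.
  by rewrite -sumrB; apply: rpred_sum => l cl; apply: Gf.
under eq_bigr do rewrite linear_sum.
rewrite exchange_big; apply: eq_bigr => k _ /=.
under eq_bigr do rewrite linear_sum.
rewrite exchange_big scaler_sumr; apply: eq_bigr => l _ /=.
rewrite scaler_sumr; apply: eq_bigr => j _.
by rewrite (linearZ_LR (euler j)) scalerA.
Qed.

(** The part of [u] in the span of the new cell [c] is made a boundary; the rest
    already lies in the span of [C]. *)
Lemma cell_koszul c C (u : 'I_r -> P) :
    c \notin C -> upclosed C ->
    (forall k m, cell m = c -> c k != bnd k -> cell (diag_mnm k + m) \in C) ->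
    cell_exact c ->
    (forall i, u i \in cell_span (c |: C)) -> \sum_i euler i (u i) \in cell_span C ->
  exists q : 'I_r -> 'I_r -> P,
    (forall i j, q j i = - q i j) /\
    forall i, u i - \sum_j euler j (q i j) \in cell_span C.
Proof.
move=> cC uC cup cE uc uE; pose v i := proj (fun m => cell m \in [set c]%SET) (u i).
have vc i : v i \in cell_span [set c] by apply: proj_supported.
have uvC i : u i - v i \in cell_span C.
  have uc' : u i - v i \in cell_span (c |: C).
    by rewrite rpredB //; apply: sub_supported (vc i) => m; rewrite !inE => ->.
  have := sub_proj_supported (fun m => cell m \in [set c]%SET) (u i).
  move=> /supportedP nc; apply/supportedP => m mv.
  move/supportedP/(_ m mv): uc'; move: (nc m mv).
  by rewrite !inE => /negbTE ->.
have vE : \sum_i euler i (v i) \in cell_span C.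
  have -> : \sum_i euler i (v i) =
      \sum_i euler i (u i) - \sum_i euler i (u i - v i).
    rewrite -sumrB; apply: eq_bigr => i _.
    by rewrite (linearB (euler i)) opprB addrC subrK.
  by rewrite rpredB // rpred_sum // => i _; apply: euler_supported.
have [q [_ qanti qE]] : exists q : 'I_r -> 'I_r -> P,
    [/\ forall i j, q i j \in cell_span [set c], forall i j, q j i = - q i j &
        forall i, v i - \sum_j euler j (q i j) \in cell_span C].
  case: cE => [[y [y0 ys]]|[G [BG GB]]]; first exact: cell_koszul1 ys vc vE.
  exact: cell_koszul2 BG GB vc vE.
exists q; split=> // i; have := rpredD (uvC i) (qE i).
by rewrite addrA subrK.
Qed.

(** The cells outside of [C] are added one at a time. For a cell of maximal total
    degree, raising a bounded exponent always lands in [C]. *)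
Lemma euler_koszul_exact C (u : 'I_r -> P) :
    upclosed C -> (forall c, c \notin C -> cell_exact c) ->
    \sum_i euler i (u i) \in cell_span C ->
  exists q : 'I_r -> 'I_r -> P,
    (forall i j, q j i = - q i j) /\
    forall i, u i - \sum_j euler j (q i j) \in cell_span C.
Proof.
have [h] := ubnP #|~: C|; elim: h C u => // h IHh C u Ch uC CE uE.
have [CT|[c0 c0C]] := set_0Vmem (~: C).
  exists (fun _ _ => 0); split=> [i j|i]; first by rewrite oppr0.
  by apply/supportedP => m _; move/setP/(_ (cell m)): CT; rewrite !inE => /negbFE.
pose c := [arg max_(c > c0 | c \notin C) (\sum_l c l)%N].
have [cC cmax] : c \notin C /\ forall c', c' \notin C -> (\sum_l c' l <= \sum_l c l)%N.
  by rewrite /c; case: arg_maxnP => [|c' c'C cm]; [rewrite inE in c0C|split].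
have cup k m : cell m = c -> c k != bnd k -> cell (diag_mnm k + m) \in C.
  move=> mc ck; apply: contraT => /cmax; rewrite leqNgt -{1}mc cell_diag_sum //.
  move: ck; rewrite -mc -val_eqE /= cellE; apply: contraR; rewrite -leqNgt.
  by move/minn_idPr => ->.
have [||c'||q [qanti qE]] := IHh (c |: C) u.
- rewrite -ltnS; apply: leq_trans Ch; rewrite ltnS; apply: proper_card.
  rewrite finset.setCU; apply/properP; split; first exact: finset.subsetIr.
  by exists c; rewrite !inE ?eqxx.
- move=> k m; rewrite !inE => /orP[/eqP mc|/uC ->]; last by rewrite orbT.
  have [ck|ck] := eqVneq (c k) (bnd k); last by rewrite cup ?orbT.
  rewrite cell_diag ?mc ?eqxx //.
  by move/(congr1 val): ck; rewrite -mc /= cellE => /minn_idPr.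
- by rewrite !inE negb_or => /andP[_]; apply: CE.
- by apply: sub_supported uE => m; rewrite !inE => ->; rewrite orbT.
have [||q' [q'anti q'E]] := @cell_koszul c C (fun i => u i - \sum_j euler j (q i j)) cC uC cup (CE _ cC).
- exact: qE.
- rewrite (_ : \sum_i _ = \sum_i euler i (u i)) //.
  rewrite -[RHS]subr0 -[X in _ - X](sum_euler_antisym qanti) -sumrB.
  by apply: eq_bigr => i _; rewrite (linearB (euler i)).
exists (fun i j => q i j + q' i j); split=> [i j|i]; first by rewrite qanti q'anti opprD.
have -> : \sum_j euler j (q i j + q' i j) =
    \sum_j euler j (q i j) + \sum_j euler j (q' i j).
  by rewrite -big_split; apply: eq_bigr => j _; rewrite (linearD (euler j)).
by rewrite opprD addrA; apply: q'E.
Qed.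

End GenericEuler.

(** * Spans, left ideals and initial ideals *)

Section Spans.
Variables (R : nzRingType) (V : lmodType R) (X : set V).

Lemma lspan0 : lspan X 0.
Proof. by exists [::]; rewrite big_nil. Qed.

Lemma mem_lspan v : X v -> lspan X v.
Proof.
move=> Xv; exists [:: (1, v)]; rewrite big_seq1 scale1r; split=> // q.
by rewrite inE => /eqP ->.
Qed.

Lemma lspanD u v : lspan X u -> lspan X v -> lspan X (u + v).
Proof.
move=> [s [sX ->]] [s' [s'X ->]]; exists (s ++ s'); rewrite big_cat; split=> // q.
by rewrite mem_cat => /orP[/sX|/s'X].
Qed.

Lemma lspan_sum (I : Type) (r : seq I) (F : I -> V) :
  (forall i, lspan X (F i)) -> lspan X (\sum_(i <- r) F i).
Proof.
by move=> XF; elim/big_ind: _ => //; [exact: lspan0|move=> u v; exact: lspanD].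
Qed.

Lemma lspan_closed_ind (G : V -> Prop) :
    G 0 -> (forall u v, G u -> G v -> G (u + v)) ->
    (forall c v, X v -> G (c *: v)) ->
  forall v, lspan X v -> G v.
Proof.
move=> G0 GD GX v [s [sX ->]]; rewrite big_seq; elim/big_ind: _ => // q /sX.
exact: GX.
Qed.

End Spans.

Section Ideals.
Variables (S : nzRingType) (X : set S).

Lemma lideal0 : lideal X 0.
Proof. by exists [::]; rewrite big_nil. Qed.

Lemma mem_lideal p : X p -> lideal X p.
Proof.
move=> Xp; exists [:: (1, p)]; rewrite big_seq1 mul1r; split=> // q.
by rewrite inE => /eqP ->.
Qed.

Lemma lidealD p q : lideal X p -> lideal X q -> lideal X (p + q).
Proof.
move=> [s [sX ->]] [s' [s'X ->]]; exists (s ++ s'); rewrite big_cat; split=> // u.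
by rewrite mem_cat => /orP[/sX|/s'X].
Qed.

Lemma lidealMl a p : lideal X p -> lideal X (a * p).
Proof.
move=> [s [sX ->]]; exists [seq (a * q.1, q.2) | q <- s]; split=> [_ /mapP[q qs ->]|].
  exact: (sX q).
by rewrite big_map mulr_sumr; apply: eq_bigr => q _; rewrite mulrA.
Qed.

Lemma lideal_sum (I : Type) (r : seq I) (F : I -> S) :
  (forall i, lideal X (F i)) -> lideal X (\sum_(i <- r) F i).
Proof.
by move=> XF; elim/big_ind: _ => //; [exact: lideal0|move=> u v; exact: lidealD].
Qed.

Lemma lideal_ind (G : S -> Prop) :
    G 0 -> (forall p q, G p -> G q -> G (p + q)) ->
    (forall a p, X p -> G (a * p)) ->
  forall p, lideal X p -> G p.
Proof.
move=> G0 GD GX p [s [sX ->]]; rewrite big_seq; elim/big_ind: _ => // q /sX.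
exact: GX.
Qed.

End Ideals.

Lemma lidealZ (R : comNzRingType) N (X : set (weyl R N)) c p :
  lideal X p -> lideal X (c *: p).
Proof. by move=> /(lidealMl c%:A); rewrite mulr_algl. Qed.

Section Graded.
Variables (R : comNzRingType) (N : nat) (tau : 'rV[int]_(N + N)).
Local Notation P := {mpoly R[N + N]}.
Implicit Types (p : P) (m : 'X_{1..N + N}) (e : int).

Definition of_weight e : {pred P} := supported (fun m => weight tau m == e).
Definition weight_le e : {pred P} := supported (fun m => weight tau m <= e).
Definition wcomp e : P -> P := proj (fun m => weight tau m == e).

HB.instance Definition _ e := GRing.Linear.copy (wcomp e)
  (proj (R := R) (fun m => weight tau m == e)).

Lemma weightD m m' : weight tau (m + m') = weight tau m + weight tau m'.
Proof.
rewrite /weight -big_split; apply: eq_bigr => k _ /=.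
by rewrite mnmDE PoszD mulrDr.
Qed.

Lemma of_weight_wcomp e p : wcomp e p \in of_weight e.
Proof. exact: proj_supported. Qed.

Lemma of_weight_le e p : p \in of_weight e -> p \in weight_le e.
Proof. by apply: sub_supported => m /eqP ->. Qed.

Lemma weight_le_trans e e' p : e <= e' -> p \in weight_le e -> p \in weight_le e'.
Proof. by move=> ee'; apply: sub_supported => m /le_trans; apply. Qed.

Lemma wcomp_id e p : p \in of_weight e -> wcomp e p = p.
Proof. exact: proj_id. Qed.

Lemma wcomp_of_weight e e' p :
  p \in of_weight e' -> wcomp e p = if e == e' then p else 0.
Proof.
case: eqVneq => [-> /wcomp_id //|ee' pe']; apply: proj0.
by apply: sub_supported pe' => m /eqP ->; rewrite eq_sym.
Qed.

Lemma wcomp_lt e e' p : e' < e -> p \in weight_le e' -> wcomp e p = 0.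
Proof.
move=> ee' pe'; apply: proj0; apply: sub_supported pe' => m me'.
by rewrite lt_eqF // (le_lt_trans me').
Qed.

Lemma wcomp_comp e e' p : wcomp e (wcomp e' p) = if e == e' then wcomp e p else 0.
Proof.
rewrite (wcomp_of_weight _ (of_weight_wcomp e' p)).
by case: eqVneq => [->|].
Qed.

(** Weights are integers. *)
Lemma weight_le_wcomp0 e p : p \in weight_le e -> wcomp e p = 0 -> p \in weight_le (e - 1).
Proof.
move=> /supportedP pe p0; apply/supportedP => m mp.
have := pe m mp; rewrite le_eqVlt => /orP[/eqP me|]; last by rewrite lerBrDr lezD1.
by move: mp; have /(congr1 (mcoeff m)) := p0; rewrite mcoeff_proj me eqxx mcoeff0 => ->; rewrite eqxx.
Qed.

Definition weights p : seq int := undup [seq weight tau m | m <- msupp p].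

Lemma sum_wcomp p : p = \sum_(e <- weights p) wcomp e p.
Proof.
apply/mpolyP => m; rewrite linear_sum /=.
under eq_bigr do rewrite mcoeff_proj eq_sym.
have [->|pm] := eqVneq p@_m 0; first by rewrite big1 // => e _; case: ifP.
rewrite -big_mkcond -big_filter /=.
rewrite (_ : [seq _ <- _ | _] = [:: weight tau m]) ?big_seq1 //.
have uw : uniq [seq e <- weights p | e == weight tau m] by rewrite filter_uniq ?undup_uniq.
apply: perm_small_eq => //; apply: uniq_perm => // e; rewrite mem_filter mem_undup inE.
by case: eqVneq => //= ->; rewrite map_f // mcoeff_msupp.
Qed.

Lemma weight_bound p : exists k : nat, p \in weight_le k%:Z.
Proof.
exists (\sum_(m <- msupp p) `|weight tau m|)%N; apply/supportedP => m.
rewrite -mcoeff_msupp => mp; rewrite (big_rem m mp) /=.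
by rewrite (le_trans (lez_abs _)) // lez_nat leq_addr.
Qed.

Lemma initial_formE e p :
  p \in weight_le e -> wcomp e p != 0 -> initial_form tau p = wcomp e p.
Proof.
move=> /supportedP pe p0; rewrite /initial_form /wcomp /proj /lin_ext big_mkcond.
rewrite big_seq [RHS]big_seq; apply: eq_bigr => m; rewrite mcoeff_msupp => mp.
case: ifP => [/allP H|nmax]; case: (weight tau m =P e) => [me|/eqP me] //.
  case/eqP: p0; apply: proj0; apply/supportedP => m' m'p; apply/negP => /eqP m'e.
  move: me; rewrite eq_le (pe _ mp) /= => /negP; case; rewrite -m'e.
  by apply: H; rewrite mcoeff_msupp.
  case/negP: nmax; apply/allP => m'; rewrite mcoeff_msupp => /pe; rewrite me; exact.
by rewrite scaler0.
Qed.

Lemma initial_formP p : p != 0 ->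
  exists e, [/\ p \in weight_le e, wcomp e p != 0 & initial_form tau p = wcomp e p].
Proof.
move=> p0; suff [e [pe we]] : exists e, p \in weight_le e /\ wcomp e p != 0.
  by exists e; rewrite (initial_formE pe we).
apply: contrapT => none; have [k pk] := weight_bound p.
have pj (j : nat) : p \in weight_le (k%:Z - j%:Z).
  elim: j => [|j IHj]; first by rewrite subr0.
  rewrite -addn1 PoszD opprD addrA; apply: weight_le_wcomp0 => //.
  by apply/eqP; apply: contrapT => /negP we; apply: none; exists (k%:Z - j%:Z).
(* If all top parts vanished, the weight of a given monomial of [p] would be
   smaller than every integer. *)
pose D := k%:Z - weight tau (mlead p) + 1.
have /supportedP/(_ (mlead p)) := pj (absz D).
rewrite -/(mleadc p) mleadc_eq0 => /(_ p0); rewrite lerBrDr -lerBrDl.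
by move=> /(le_trans (lez_abs D)); rewrite gerDl.
Qed.

(** Zero is allowed as leading form here, which makes the description additive in
    [p] and compatible with the decomposition into weights. *)
Lemma initial_lidealE (X : set (weyl R N)) (p : weyl R N) :
  initial_ideal tau (lideal X) p <->
    forall e, exists2 l : P, lideal X l & l \in weight_le e /\ wcomp e l = wcomp e p.
Proof.
split; last first.
  move=> H; rewrite [p]sum_wcomp; apply: lspan_sum => e.
  have [l Il [le <-]] := H e; have [->|we] := eqVneq (wcomp e l) 0.
    exact: lspan0.
  apply: mem_lspan; exists l; last exact: initial_formE.
  by split=> //; apply: contra_neq we => ->; rewrite linear0.
move: p; apply: lspan_closed_ind => [e|p q IHp IHq e|c _ [l [Il l0] <-] e].
- by exists 0; [exact: lideal0|split; first exact: rpred0].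
- have [l Il [le lp]] := IHp e; have [l' Il' [le' lq]] := IHq e.
  exists (l + l'); first exact: lidealD.
  split; first exact: rpredD.
  by rewrite (linearD (wcomp e)) [RHS](linearD (wcomp e)) /= lp lq.
have [e' [le' we' ->]] := initial_formP l0.
have [->|ee'] := eqVneq e e'.
  exists (c *: l); first exact: lidealZ.
  by split; [exact: rpredZ|rewrite !(linearZ_LR (wcomp e')) /= wcomp_comp eqxx].
exists 0; first exact: lideal0.
split; first exact: rpred0.
by rewrite (linearZ_LR (wcomp e)) /= wcomp_comp (negbTE ee') linear0 scaler0.
Qed.

End Graded.

(** * Reordering one variable and its derivation *)

Lemma linear_mul_ext (R : comNzRingType) k (V : lmodType R)
    (f g : {linear {mpoly R[k]} -> V}) (a : {mpoly R[k]}) :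
  (forall m, f (a * 'X_[m]) = g 'X_[m]) -> forall p, f (a * p) = g p.
Proof.
move=> fg p; rewrite [p]mpolyE mulr_sumr !linear_sum; apply: eq_bigr => m _.
by rewrite -scalerAr !linearZ_LR fg.
Qed.

Section Reorder.
Variables (R : comNzRingType) (N : nat) (t : 'I_N).
Local Notation P := {mpoly R[N + N]}.
Local Notation xi k := (lshift N k).
Local Notation di k := (rshift N k).
Implicit Types (p q : P) (m : 'X_{1..N + N}) (s : R).

Definition twist s : P -> P := fun q => 'X_(xi t) * q + s *: q^`M(di t).

Lemma twist_is_linear s : linear (twist s).
Proof.
move=> a p q; rewrite /twist mderivD mderivZ mulrDr !scalerDr -scalerAr addrACA.
by rewrite !scalerA (mulrC s).
Qed.

HB.instance Definition _ s :=
  GRing.isLinear.Build R P P *:%R (twist s) (twist_is_linear s).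

Lemma twist_mderiv s q : twist s q^`M(di t) = (twist s q)^`M(di t).
Proof.
by rewrite /twist mderivD mderivM mderivXX eq_rlshift mul0r add0r mderivZ.
Qed.

Lemma twistX s m' q : m' (di t) = 0%N ->
  twist s ('X_[m'] * q) = 'X_[m'] * twist s q.
Proof.
move=> m't; rewrite /twist mderivM mderivX m't scale0r mul0r add0r mulrDr mulrCA.
by rewrite scalerAr.
Qed.

Lemma iter_twist_mderiv s k q :
  iter k (twist s) q^`M(di t) = (iter k (twist s) q)^`M(di t).
Proof. by elim: k => //= k ->; rewrite twist_mderiv. Qed.

Definition strip m : 'X_{1..N + N} :=
  [multinom if i == xi t then 0%N else m i | i < N + N].

Lemma stripE m i : strip m i = if i == xi t then 0%N else m i.
Proof. exact: mnmE. Qed.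

Lemma stripD m m' : strip (m + m') = (strip m + strip m')%MM.
Proof. by apply/mnmP => i; rewrite mnmDE !stripE mnmDE; case: eqP. Qed.

Lemma strip_id m : m (xi t) = 0%N -> strip m = m.
Proof. by move=> mt; apply/mnmP => i; rewrite stripE; case: eqP => // ->. Qed.

Lemma strip_xt : strip U_(xi t) = 0%MM.
Proof. by apply/mnmP => i; rewrite stripE mnm1E mnm0E eq_sym; case: eqP. Qed.

Lemma stripK m : (U_(xi t) *+ m (xi t) + strip m)%MM = m.
Proof.
apply/mnmP => i; rewrite mnmDE mulmnE mnm1E stripE eq_sym.
by case: eqP => [->|_]; rewrite ?mul1n ?addn0 ?mul0n ?add0n.
Qed.

(** For [s = -1] this rewrites an operator with all derivations [d_t] to the
    left of all [t]: in such coordinates right multiplication by [t] is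
    multiplication by a variable. For [s = 1] it is the inverse rewriting. *)
Definition reorder s : P -> P :=
  lin_ext (fun m => iter (m (xi t)) (twist s) 'X_[strip m]).

HB.instance Definition _ s := GRing.Linear.copy (reorder s)
  (lin_ext (fun m => iter (m (xi t)) (twist s) ('X_[strip m] : P))).

Lemma reorderE s m : reorder s 'X_[m] = iter (m (xi t)) (twist s) 'X_[strip m].
Proof. exact: lin_extX. Qed.

Lemma reorder_t s p : reorder s ('X_(xi t) * p) = twist s (reorder s p).
Proof.
apply: (linear_mul_ext (f := reorder s) (g := twist s \o reorder s)) => m /=.
by rewrite -mpolyXD !reorderE stripD strip_xt add0m mnmDE mnm1E eqxx.
Qed.

Lemma reorderX s m' p : m' (xi t) = 0%N -> m' (di t) = 0%N ->
  reorder s ('X_[m'] * p) = 'X_[m'] * reorder s p.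
Proof.
move=> m'x m'd; rewrite [p]mpolyE mulr_sumr !(linear_sum (reorder s)) mulr_sumr.
apply: eq_bigr => m _; rewrite -scalerAr !(linearZ_LR (reorder s)) -scalerAr /=.
congr (_ *: _); rewrite -mpolyXD !reorderE stripD mnmDE m'x add0n mpolyXD strip_id //.
by elim: (m _) => //= k ->; rewrite twistX.
Qed.

Lemma reorder_mderiv s p : reorder s p^`M(di t) = (reorder s p)^`M(di t).
Proof.
apply: (linear_mpoly_ext (f := reorder s \o mderiv (di t)) (g := mderiv (di t) \o reorder s)) => m /=.
rewrite mderivX linearZ_LR /= !reorderE -iter_twist_mderiv mderivX.
rewrite mnmBE mnm1E eq_rlshift subn0 stripE eq_rlshift.
rewrite (_ : strip (m - U_(di t)) = (strip m - U_(di t))%MM); last first.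
  by apply/mnmP => i; rewrite stripE !mnmBE mnm1E stripE; case: eqP.
by elim: (m (xi t)) => //= k <-; rewrite linearZ_LR.
Qed.

Lemma reorderK s p : reorder s (reorder (- s) p) = p.
Proof.
apply: (linear_mpoly_ext (f := reorder s \o reorder (- s)) (g := idfun)) => m /=.
rewrite (reorderE (- s)) -[in RHS](stripK m) mpolyXD.
elim: (m (xi t)) => [|k IHk] /=.
  rewrite mulm0n mpolyX0 mul1r reorderE stripE eqxx /= strip_id ?stripE ?eqxx //.
rewrite /twist (linearD (reorder s)) (linearZ_LR (reorder s)) /= reorder_t /twist.
by rewrite reorder_mderiv scaleNr addrK IHk mulmS mpolyXD mulrA.
Qed.

(** Reordering [t^k d^l] produces the monomials [t^(k-j) d^(l-j)], so [S] only
    has to be stable under removing factors [t d]. *)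
Lemma reorder_in s (S : pred 'X_{1..N + N}) p :
    (forall m, (0 < m (di t))%N -> S (U_(xi t) + m)%MM -> S (m - U_(di t))%MM) ->
  p \in supported S -> reorder s p \in supported S.
Proof.
move=> Std; apply: linear_supported => m Sm /=; rewrite reorderE.
suff /(_ (m (xi t)) 0%N) : forall k j, (j + k)%N = m (xi t) ->
    iter k (twist s) 'X_[strip m] \in
      supported (fun m' => S (U_(xi t) *+ j + m')%MM).
  by rewrite add0n => /(_ erefl); apply: sub_supported => m'; rewrite mulm0n add0m.
elim=> [|k IHk] j jk /=; first by rewrite supportedX -[j]addn0 jk stripK.
have := IHk j.+1; rewrite addSnnS => /(_ jk).
apply: (linear_supported (f := twist s)) => m'; rewrite mulmS -addmA => Sm' /=.
rewrite /twist -mpolyXD mderivX; apply: rpredD.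
  by rewrite supportedX addmA [(_ *+ _ + _)%MM]addmC -addmA.
have [->|mt] := posnP (m' (di t)); first by rewrite scale0r scaler0 rpred0.
rewrite !rpredZ // supportedX.
have -> : (U_(xi t) *+ j + (m' - U_(di t)) = (U_(xi t) *+ j + m') - U_(di t))%MM.
  apply/mnmP => i; rewrite mnmDE !mnmBE mnmDE mnm1E.
  by case: eqP => [<-|_]; rewrite ?addnBA // !subn0.
by apply: Std => //; rewrite mnmDE ltn_addl.
Qed.

End Reorder.

(** * The initial ideal of the toric operators *)

Section Toric.
Variables (R : comNzRingType) (d n : nat) (A : 'M[int]_(d, n)) (w : 'rV[int]_n).
Local Notation N := (n + 1)%N.
Local Notation P := {mpoly R[N + N]}.
Local Notation W := (weyl R N).
Local Notation t := (rshift n ord0 : 'I_N).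
Local Notation xi k := (lshift N k).
Local Notation di k := (rshift N k).
Local Notation wt := (weight (tau n)).
Implicit Types (p q : P) (m : 'X_{1..N + N}) (u v : 'X_{1..N}).

Lemma weight_tau m : wt m = (m (di t))%:Z - (m (xi t))%:Z.
Proof.
rewrite /weight /tau !big_split_ord /= !big_ord1.
rewrite !big1 => [|k _|k _]; rewrite ?row_mxEl ?row_mxEr ?row_mxEl ?mxE ?mul0r //.
by rewrite !add0r addrC mulN1r mul1r.
Qed.

Lemma weight_twist m : (0 < m (di t))%N -> 
  wt (U_(xi t) + m) = wt (m - U_(di t)).
Proof.
move=> mt; rewrite !weight_tau !mnmDE !mnmBE !mnm1E !eqxx eq_rlshift eq_lrshift.
by rewrite add0n subn0 add1n subn1 -{1}(prednK mt) -[(m _).+1]addn1 -[_.-1.+1]addn1 !PoszD opprD addrACA subrr addr0.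
Qed.

Lemma wcomp_reorder s e p :
  wcomp (tau n) e (reorder t s p) = reorder t s (wcomp (tau n) e p).
Proof.
apply: (linear_mpoly_ext (f := wcomp (tau n) e \o reorder t s)
  (g := reorder t s \o wcomp (tau n) e)) => m /=.
have Xm : ('X_[m] : P) \in of_weight (tau n) (wt m) by rewrite /of_weight supportedX.
rewrite (wcomp_of_weight _ Xm) (@wcomp_of_weight _ _ (tau n) e (wt m)).
  by case: ifP; rewrite ?linear0.
by apply: reorder_in Xm => m' m't; rewrite weight_twist.
Qed.

Lemma weight_le_reorder s e p :
  p \in weight_le (tau n) e -> reorder t s p \in weight_le (tau n) e.
Proof. by apply: reorder_in => m mt; rewrite weight_twist. Qed.

Definition dt_mnm u : 'X_{1..N + N} :=
  [multinom match split i with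
            | inl k => if k == t then u k else 0%N
            | inr k => if k == t then 0%N else u k
            end | i < N + N].

Lemma dt_mnm_x u k : dt_mnm u (xi k) = if k == t then u k else 0%N.
Proof. by rewrite mnmE -[xi k]/(unsplit (inl k)) unsplitK. Qed.

Lemma dt_mnm_d u k : dt_mnm u (di k) = if k == t then 0%N else u k.
Proof. by rewrite mnmE -[di k]/(unsplit (inr k)) unsplitK. Qed.

Definition dt_gen k : W :=
  match split k with
  | inl j => wd (lshift 1 j)
  | inr j => wx (rshift n j)
  end.

Lemma reorder_mulr_gen (Q : W) k :
  reorder t (-1) (Q * dt_gen k) = 'X_[dt_mnm U_(k)] * reorder t (-1) Q.
Proof.
rewrite /dt_gen; case: (split_ordP k) => j ->.
  rewrite weyl_mulr_d -reorderX; first congr (reorder _ _ ('X_[_] * _)).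
  - apply/mnmP => i; case: (split_ordP i) => i' ->.
      rewrite dt_mnm_x !mnm1E eq_rlshift; case: eqP => [->|] //.
      by rewrite eq_lrshift.
    rewrite dt_mnm_d !mnm1E eq_rshift; case: (i' =P t) => [->|] //.
    by rewrite eq_lrshift.
  - by rewrite dt_mnm_x eqxx mnm1E eq_lrshift.
  - by rewrite dt_mnm_d eqxx.
rewrite (ord1 j) weyl_mulr_x (linearD (reorder t (-1))) /= reorder_t reorder_mderiv.
rewrite /twist scaleN1r subrK; congr ('X_[_] * _).
apply/mnmP => i; case: (split_ordP i) => i' ->.
  by rewrite dt_mnm_x !mnm1E eq_lshift eq_sym; case: (i' == t).
rewrite dt_mnm_d !mnm1E eq_lrshift; case: (i' =P t) => [|/eqP/negbTE it] //.
by rewrite eq_sym it.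
Qed.

Definition dt_poly : {mpoly R[N]} -> P :=
  mmap (@mpolyC (N + N) R) (fun k => 'X_[dt_mnm U_(k)]).

HB.instance Definition _ := GRing.RMorphism.copy dt_poly
  (mmap (@mpolyC (N + N) R) (fun k => 'X_[dt_mnm U_(k)])).

Lemma dt_mnmD u v : dt_mnm (u + v) = (dt_mnm u + dt_mnm v)%MM.
Proof.
apply/mnmP => i; case: (split_ordP i) => k ->.
  by rewrite mnmDE !dt_mnm_x mnmDE; case: ifP.
by rewrite mnmDE !dt_mnm_d mnmDE; case: ifP.
Qed.

Lemma dt_mnm0 : dt_mnm 0 = 0%MM.
Proof.
apply/mnmP => i; case: (split_ordP i) => k ->.
  by rewrite !dt_mnm_x !mnm0E; case: ifP.
by rewrite !dt_mnm_d !mnm0E; case: ifP.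
Qed.

Lemma dt_polyX u : dt_poly 'X_[u] = 'X_[dt_mnm u].
Proof.
rewrite /dt_poly mmapX /mmap1 [in RHS](multinomUE_id u).
rewrite (big_morph dt_mnm dt_mnmD dt_mnm0).
rewrite (big_morph _ (@mpolyXD (N + N) R) (@mpolyX0 (N + N) R)); apply: eq_bigr => k _.
rewrite mpolyXn; congr 'X_[_]; elim: (u k) => [|e IHe]; first by rewrite !mulm0n dt_mnm0.
by rewrite !mulmS dt_mnmD IHe.
Qed.

Lemma dt_embedE (f : {mpoly R[N]}) :
  dt_embed f = \sum_(u <- msupp f) f@_u *: mmap1 dt_gen u :> W.
Proof. by apply: eq_bigr => u _; rewrite -mulr_algl. Qed.

Lemma dt_embedX u : dt_embed 'X_[u] = mmap1 dt_gen u :> W.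
Proof. by rewrite dt_embedE msuppX big_seq1 mcoeffX eqxx scale1r. Qed.

Lemma reorder_mulr_dt (Q : W) f :
  reorder t (-1) (Q * dt_embed f) = dt_poly f * reorder t (-1) Q.
Proof.
have genX k e (Q' : W) : reorder t (-1) (Q' * dt_gen k ^+ e) =
    'X_[dt_mnm U_(k)] ^+ e * reorder t (-1) Q'.
  elim: e => [|e IHe]; first by rewrite !expr0 mulr1 mul1r.
  by rewrite exprSr mulrA reorder_mulr_gen IHe exprS mulrA.
have monX u : reorder t (-1) (Q * mmap1 dt_gen u) = dt_poly 'X_[u] * reorder t (-1) Q.
  rewrite /dt_poly mmapX /mmap1; elim: (index_enum _) Q => [|k s IHs] Q'.
    by rewrite !big_nil mulr1 mul1r.
  by rewrite !big_cons mulrA IHs genX mulrCA mulrA.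
rewrite dt_embedE mulr_sumr (linear_sum (reorder t (-1))) [in RHS](mpolyE f).
rewrite rmorph_sum mulr_suml; apply: eq_bigr => u _.
rewrite -scalerAr (linearZ_LR (reorder t (-1))) /= monX -mul_mpolyC rmorphM /=.
by rewrite -mulrA -mul_mpolyC /dt_poly mmapC.
Qed.

Lemma reorder_inj p q : reorder t (-1) p = reorder t (-1) q -> p = q.
Proof. by move=> pq; rewrite -(reorderK t 1 p) pq reorderK. Qed.

(** The images of the variables commute with each other but not with all of the
    Weyl algebra; in the reordered coordinates the products become commutative
    ones. *)
Lemma dt_embedM f g : dt_embed (f * g) = dt_embed f * dt_embed g :> W.
Proof.
apply: reorder_inj; rewrite reorder_mulr_dt -[dt_embed f]mul1r reorder_mulr_dt.
by rewrite -[dt_embed _]mul1r reorder_mulr_dt rmorphM /= mulrA [dt_poly g * _]mulrC.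
Qed.

Lemma dt_embed0 : dt_embed 0 = 0 :> W.
Proof. by rewrite dt_embedE msupp0 big_nil. Qed.

Lemma dt_embedD f g : dt_embed (f + g) = dt_embed f + dt_embed g :> W.
Proof.
apply: reorder_inj; rewrite (linearD (reorder t (-1))) /=.
by rewrite -[dt_embed _]mul1r -[X in _ = reorder _ _ X + _]mul1r -[X in _ = _ + reorder _ _ X]mul1r
  !reorder_mulr_dt rmorphD mulrDl.
Qed.

Lemma dt_embedB f g : dt_embed (f - g) = dt_embed f - dt_embed g :> W.
Proof. by apply/eqP; rewrite eq_sym subr_eq -dt_embedD subrK. Qed.

End Toric.

Section ToricInitial.
Variables (R : comNzRingType) (d n : nat) (A : 'M[int]_(d, n)) (w : 'rV[int]_n).
Local Notation N := (n + 1)%N.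
Local Notation P := {mpoly R[N + N]}.
Local Notation W := (weyl R N).
Local Notation t := (rshift n ord0 : 'I_N).
Local Notation xi k := (lshift N k).
Local Notation di k := (rshift N k).
Local Notation wt := (weight (tau n)).
Local Notation DI := (lideal (@toric_ops R d n A w)).
Implicit Types (p q : P) (m : 'X_{1..N + N}).

Definition wval (u : 'X_{1..n}) : int := (w *m mnm_col u) 0 0.

Definition dpart m : 'X_{1..n} := [multinom m (di (lshift 1 j)) | j < n].

Lemma dpartE m j : dpart m j = m (di (lshift 1 j)).
Proof. exact: mnmE. Qed.

Definition in_monomials (F : seq 'X_{1..n}) m : bool :=
  has (fun f => f <= dpart m)%MM F.

Lemma mnm_colD k (u v : 'X_{1..k}) : mnm_col (u + v) = mnm_col u + mnm_col v.
Proof. by apply/matrixP => i j; rewrite !mxE mnmDE. Qed.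

Definition join_mnm (u : 'X_{1..n}) (b : nat) : 'X_{1..N} :=
  [multinom match split k with inl j => u j | inr _ => b end | k < N].

Lemma join_mnm_l u b j : join_mnm u b (lshift 1 j) = u j.
Proof. by rewrite mnmE -[lshift 1 j]/(unsplit (inl j)) unsplitK. Qed.

Lemma join_mnm_r u b : join_mnm u b t = b.
Proof. by rewrite mnmE -[t]/(unsplit (inr ord0)) unsplitK. Qed.

Lemma add_scalar_mx00 (M : 'M[int]_1) z : (M + z%:M) 0 0 = M 0 0 + z.
Proof. by rewrite mxE [z%:M _ _]mxE eqxx mulr1n. Qed.

Lemma tildeA_join u b :
  tildeA A w *m mnm_col (join_mnm u b) =
  col_mx (A *m mnm_col u) (w *m mnm_col u + b%:Z%:M).
Proof.
have -> : mnm_col (join_mnm u b) = col_mx (mnm_col u) b%:Z%:M.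
  apply/matrixP => i j; rewrite !mxE; case: (split_ordP i) => k ->.
    by rewrite join_mnm_l /= !mxE.
  by rewrite (ord1 k) (ord1 j) join_mnm_r !mxE.
by rewrite /tildeA mul_block_col mul0mx addr0 mul1mx.
Qed.

Definition toric_part m : 'X_{1..N} := join_mnm (dpart m) (m (xi t)).

Lemma toric_partD u m : toric_part (dt_mnm u + m) = (u + toric_part m)%MM.
Proof.
apply/mnmP => i; case: (split_ordP i) => k ->; rewrite mnmDE.
  by rewrite !join_mnm_l !dpartE mnmDE dt_mnm_d eq_lrshift.
by rewrite (ord1 k) !join_mnm_r mnmDE dt_mnm_x eqxx.
Qed.

(** Monomials with the same class are congruent modulo the toric ideal, once
    all [d_t] are written to the left of all [t]. *)
Definition same_class m0 m : bool :=
  [&& [forall k, (k != t) ==> (m (xi k) == m0 (xi k))], m (di t) == m0 (di t) &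
      tildeA A w *m mnm_col (toric_part m) == tildeA A w *m mnm_col (toric_part m0)].

Definition class_sum m0 : P -> R^o :=
  lin_ext (fun m => (same_class m0 m)%:R : R^o).

HB.instance Definition _ m0 := GRing.Linear.copy (class_sum m0)
  (lin_ext (fun m => (same_class m0 m)%:R : R^o)).

Lemma class_sumX m0 m : class_sum m0 'X_[m] = (same_class m0 m)%:R.
Proof. exact: lin_extX. Qed.

Lemma same_class_toric m0 m (u v : 'X_{1..N}) :
    tildeA A w *m mnm_col u = tildeA A w *m mnm_col v ->
  same_class m0 (dt_mnm u + m) = same_class m0 (dt_mnm v + m).
Proof.
move=> uv; rewrite /same_class !toric_partD !mnm_colD !mulmxDr uv.
rewrite !(mnmDE (di t)) !dt_mnm_d eqxx; congr (_ && _).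
apply: eq_forallb => k; case: eqP => //= /eqP/negbTE kt.
by rewrite !mnmDE !dt_mnm_x kt.
Qed.

(** In the reordered coordinates [D I] becomes the extension of the commutative
    ideal [I], on which coefficient sums over classes vanish. *)
Lemma class_sum_toric m0 (l : W) : DI l -> class_sum m0 (reorder t (-1) l) = 0.
Proof.
move: l; apply: lideal_ind => [|p q|Q _ [f fI <-]].
- by rewrite linear0 /= linear0.
- by move=> p0 q0; rewrite linearD /= linearD /= p0 q0 addr0.
rewrite reorder_mulr_dt; move: f fI (reorder t (-1) Q).
apply: lideal_ind => [q|f g IHf IHg q|g _ [u [v [uv ->]]] q].
- by rewrite rmorph0 mul0r linear0.
- by rewrite rmorphD mulrDl linearD /= IHf IHg addr0.
rewrite rmorphM rmorphB /= !dt_polyX -mulrA mulrCA.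
move: (_ * q) => {}q; rewrite mulrBl linearB /=; apply/eqP; rewrite subr_eq0; apply/eqP.
rewrite [q]mpolyE !mulr_sumr !(linear_sum (class_sum m0)); apply: eq_bigr => m _.
rewrite -!scalerAr !(linearZ_LR (class_sum m0)) -!mpolyXD /= !class_sumX.
by rewrite (same_class_toric _ _ uv).
Qed.

Variable F : seq 'X_{1..n}.
Hypothesis F_lead : forall f, f \in F ->
  exists2 v, A *m mnm_col v = A *m mnm_col f & wval v < wval f.
Hypothesis F_min : forall u v, ~~ has (fun f => f <= u)%MM F ->
  A *m mnm_col u = A *m mnm_col v -> wval v <= wval u -> u = v.

(** A standard monomial of top weight is the only monomial of its class among the
    weights at most [e]: another one would have a smaller or equal value of [w]
    in the same fiber of [A]. So its coefficient is a class sum. *)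
Lemma toric_initial_sub (l : W) e :
    DI l -> (l : P) \in weight_le (tau n) e ->
  wcomp (tau n) e l \in supported (in_monomials F).
Proof.
move=> Il le; rewrite -(reorderK t 1 l) wcomp_reorder; apply: reorder_in.
  move=> m mt; congr (has _ _); apply/funext => f; congr (_ <= _)%MM.
  by apply/mnmP => j; rewrite !dpartE mnmDE mnmBE !mnm1E eq_lrshift eq_rshift eq_rlshift subn0.
apply/supportedPn => m0 m0F; rewrite mcoeff_proj; case: eqP => // m0e.
have := class_sum_toric m0 Il; rewrite /class_sum /lin_ext.
have /supportedP := weight_le_reorder (-1) le; move: (reorder _ _ _) => q qe.
rewrite (eq_big_seq (fun m => if m == m0 then q@_m else 0)) => [|m].
  move=> <-; rewrite -big_mkcond /= -big_filter.
  have [q0|qm0] := eqVneq q@_m0 0.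
    by rewrite q0 big1_seq // => m /=; rewrite mem_filter => /andP[/eqP ->].
  rewrite (_ : [seq _ <- _ | _] = [:: m0]) ?big_seq1 //.
  apply: perm_small_eq => //; apply: uniq_perm => [|//|m].
    by rewrite filter_uniq ?msupp_uniq.
  by rewrite mem_filter inE; case: eqP => //= ->; rewrite mcoeff_msupp.
rewrite mcoeff_msupp => /qe; rewrite -m0e !weight_tau => mm0.
case: eqP => [->|mm0ne].
  rewrite /same_class !eqxx (_ : [forall k, _]) ?scaler1 //.
    by rewrite -[RHS]mulr1.
  by apply/forallP => k; rewrite eqxx implybT.
rewrite /same_class; case: and3P => [[/forallP mx /eqP md]|]; last by rewrite scaler0.
rewrite !tildeA_join => /eqP/eq_col_mx[mA mw]; case: mm0ne.
have {mw} : wval (dpart m) + (m (xi t))%:Z = wval (dpart m0) + (m0 (xi t))%:Z.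
  by have /(congr1 (fun M : 'M_1 => M 0 0)) := mw; rewrite !add_scalar_mx00.
move=> mw; have mx0 : (m0 (xi t) <= m (xi t))%N.
  by move: mm0; rewrite md lerD2l lerN2 lez_nat.
have dm : dpart m0 = dpart m.
  apply: F_min m0F _ _; first by rewrite mA.
  by rewrite -(lerD2r (m (xi t))%:Z) mw lerD2l lez_nat.
move: mw; rewrite dm => /addrI[mxt].
apply/mnmP => i; case: (split_ordP i) => k ->.
  by have := mx k; case: eqVneq => [->|_ /eqP].
case: (split_ordP k) => j ->; last by rewrite (ord1 j).
by rewrite -!dpartE dm.
Qed.

(** The monomial is a multiple of some [d^f] with [f] in [F], and it is the
    initial form of the corresponding multiple of [d^f - d^v t^b], where [v] lies
    in the fiber of [f] and [b = w f - w v > 0]. *)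
Lemma toric_initial_lead m : in_monomials F m ->
  exists2 l : W, DI l &
    (l : P) \in weight_le (tau n) (wt m) /\ wcomp (tau n) (wt m) l = 'X_[m].
Proof.
move=> /hasP[f /F_lead[v vA vw] fm].
pose b := absz (wval f - wval v).
have bE : b%:Z = wval f - wval v by rewrite gez0_abs // subr_ge0 ltW.
have b0 : (0 < b)%N by rewrite absz_gt0 subr_eq0 gt_eqF.
pose u' := join_mnm f 0; pose v' := join_mnm v b.
have uv : tildeA A w *m mnm_col u' = tildeA A w *m mnm_col v'.
  rewrite !tildeA_join vA; congr col_mx; apply/matrixP => i j.
  by rewrite !ord1 !add_scalar_mx00 -!/(wval _) bE addr0 addrC subrK.
have um : (dt_mnm u' <= m)%MM.
  apply/mnm_lepP => i; case: (split_ordP i) => k ->.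
    by rewrite dt_mnm_x; case: eqP => // ->; rewrite join_mnm_r.
  rewrite dt_mnm_d; case: eqP => // /eqP; case: (split_ordP k) => j -> => [_|].
    by rewrite join_mnm_l -dpartE; apply: (mnm_lepP fm).
  by rewrite (ord1 j) eqxx.
pose Q : W := ('X_[m - dt_mnm u'] : P).
exists (Q * dt_embed ('X_[u'] - 'X_[v'])).
  apply/lidealMl/mem_lideal; exists ('X_[u'] - 'X_[v']) => //.
  by apply: mem_lideal; exists u', v'.
rewrite dt_embedB mulrBr.
have lead : Q * dt_embed 'X_[u'] = ('X_[m] : P).
  apply: (@reorder_inj R n); rewrite reorder_mulr_dt dt_polyX -reorderX.
  - by rewrite -mpolyXD addmC submK.
  - by rewrite dt_mnm_x eqxx join_mnm_r.
  - by rewrite dt_mnm_d eqxx.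
have tail : (Q * dt_embed 'X_[v'] : P) \in weight_le (tau n) (wt m - 1).
  rewrite -(reorderK t 1 (Q * _)) reorder_mulr_dt dt_polyX; apply: weight_le_reorder.
  have QE : reorder t (-1) Q \in of_weight (tau n) (wt m).
    apply: reorder_in => [m' m't|]; first by rewrite weight_twist.
    rewrite /of_weight supportedX -{2}(submK um) weightD (weight_tau (dt_mnm _)).
    by rewrite dt_mnm_x dt_mnm_d eqxx join_mnm_r subrr addr0.
  apply: mulX_supported QE => m' /eqP m'm.
  rewrite weightD m'm weight_tau dt_mnm_x dt_mnm_d eqxx join_mnm_r sub0r addrC.
  by rewrite lerD2l lerN2 lez_nat.
split.
  rewrite lead; apply: rpredB; first by rewrite /weight_le supportedX.
  by apply: weight_le_trans tail; rewrite gerBl.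
rewrite lead (linearB (wcomp (tau n) (wt m))) /= (wcomp_lt _ tail) ?subr0; last first.
  by rewrite ltrBlDr ltrDl.
by apply: wcomp_id; rewrite /of_weight supportedX.
Qed.

Lemma toric_initial (p : W) :
  initial_ideal (tau n) DI p <-> (p : P) \in supported (in_monomials F).
Proof.
split=> [|pF].
  move/initial_lidealE => H; rewrite [p : P](sum_wcomp (tau n)) rpred_sum // => e _.
  by have [l Il [le <-]] := H e; apply: toric_initial_sub.
apply/initial_lidealE => e; have := proj_in (fun m => wt m == e) pF.
have := of_weight_wcomp (tau n) e (p : P).
rewrite -/(wcomp _ _ _); move: (wcomp _ _ _) => q /supportedP qe /supportedP qF.
suff [l Il [le lq]] : exists2 l : W, DI l & (l : P) \in weight_le (tau n) e /\ wcomp (tau n) e l = q.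
  by exists l.
rewrite [q]mpolyE big_seq; elim/big_ind: _ => [|p1 p2|m].
- by exists 0; [exact: lideal0|rewrite rpred0 linear0].
- move=> [l1 I1 [le1 <-]] [l2 I2 [le2 <-]]; exists (l1 + l2); first exact: lidealD.
  by split; [exact: rpredD|rewrite (linearD (wcomp _ _))].
rewrite mcoeff_msupp => mq; have [l Il [le lm]] := toric_initial_lead (qF _ mq).
move/eqP: (qe _ mq) le lm => -> le lm; exists (q@_m *: l).
  exact: lidealZ.
by split; [exact: rpredZ|rewrite (linearZ_LR (wcomp _ _)) /= lm].
Qed.

End ToricInitial.

(** * The hypergeometric ideal *)

Section Hypergeometric.
Variables (K : numFieldType) (d n : nat) (A : 'M[int]_(d, n)) (w : 'rV[int]_n).
Variable beta : 'cV[K]_d.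
Local Notation N := (n + 1)%N.
Local Notation P := {mpoly K[N + N]}.
Local Notation W := (weyl K N).
Local Notation t := (rshift n ord0 : 'I_N).
Local Notation xi k := (lshift N k).
Local Notation di k := (rshift N k).
Local Notation wt := (weight (tau n)).
Local Notation DI := (lideal (@toric_ops K d n A w)).
Implicit Types (p q : P) (i j : 'I_(d + 1)).

Definition euler_mx : 'M[K]_(d + 1, n + 1) :=
  block_mx (map_mx intr A) 0 (map_mx intr w) (-1)%:M.

Definition euler_shift i : K :=
  match split i with inl k => beta k 0 | inr _ => 0 end.

Definition euler_gen i : W :=
  match split i with inl k => euler_op A beta k | inr _ => weight_euler_op K w end.

Local Notation eul := (euler euler_mx euler_shift).

Lemma euler_genE i :
  euler_gen i =
  \sum_k euler_mx i k *: (wx k * wd k) - (euler_shift i)%:A :> W.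
Proof.
rewrite /euler_gen /euler_shift /euler_mx big_split_ord big_ord1 /=.
case: (split_ordP i) => k ->.
  rewrite block_mxEur mxE scale0r addr0; congr (_ - _); apply: eq_bigr => l _.
  by rewrite block_mxEul mxE.
rewrite block_mxEdr (ord1 k) mxE eqxx mulr1n scaleN1r scale0r subr0.
by congr (_ - _); apply: eq_bigr => l _; rewrite block_mxEdl mxE.
Qed.

Lemma mulr_euler_gen i (Q : W) : Q * euler_gen i = eul i Q :> P.
Proof.
rewrite euler_genE mulrBr mulr_sumr -scalerAr mulr1; congr (_ - _).
by apply: eq_bigr => k _; rewrite -scalerAr -weyl_mulr_xd.
Qed.

Lemma euler_opsP (X : W) : euler_ops A w beta X <-> exists i, X = euler_gen i.
Proof.
split=> [[[k _ <-]|->]|[i ->]].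
- exists (lshift 1 k); rewrite /euler_gen -[lshift 1 k]/(unsplit (inl k)).
  by rewrite unsplitK.
- exists (rshift d ord0); rewrite /euler_gen -[rshift d ord0]/(unsplit (inr ord0)).
  by rewrite unsplitK.
by rewrite /euler_gen; case: (split i) => k; [left; exists k|right].
Qed.

Definition euler_sum (Q : 'I_(d + 1) -> W) : W := \sum_i Q i * euler_gen i.

Lemma lideal_euler_opsP (p : W) :
  lideal (euler_ops A w beta) p <-> exists Q, p = euler_sum Q.
Proof.
split; last first.
  case=> Q ->; apply: lideal_sum => i; apply/lidealMl/mem_lideal/euler_opsP.
  by exists i.
move: p; apply: lideal_ind => [|_ _ [Q1 ->] [Q2 ->]|a _ /euler_opsP[i ->]].
- by exists (fun=> 0); rewrite /euler_sum big1 // => i _; rewrite mul0r.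
- exists (fun i => Q1 i + Q2 i); rewrite /euler_sum -big_split.
  by apply: eq_bigr => i _; rewrite mulrDl.
exists (fun j => if j == i then a else 0); rewrite /euler_sum (bigD1 i) //= eqxx.
by rewrite big1 ?addr0 // => j /negbTE ->; rewrite mul0r.
Qed.

Lemma hypergeometricP (l : W) : modified_hypergeometric_ideal A w beta l <->
  exists (p : W) (Q : 'I_(d + 1) -> W), DI p /\ l = p + euler_sum Q.
Proof.
split; last first.
  case=> p [Q [Ip ->]]; apply: lidealD; last first.
    apply: lideal_sum => i; apply/lidealMl/mem_lideal; left; apply/euler_opsP.
    by exists i.
  move: p Ip; apply: lideal_ind => [|p q|a p Xp]; first exact: lideal0.
    exact: lidealD.
  by apply/lidealMl/mem_lideal; right.
move: l; apply: lideal_ind => [|_ _ [p1 [Q1 [I1 ->]]] [p2 [Q2 [I2 ->]]]|a p [|]].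
- exists 0, (fun=> 0); split; first exact: lideal0.
  by rewrite /euler_sum big1 ?addr0 // => i _; rewrite mul0r.
- exists (p1 + p2), (fun i => Q1 i + Q2 i); split; first exact: lidealD.
  rewrite addrACA; congr (_ + _); rewrite /euler_sum -big_split.
  by apply: eq_bigr => i _; rewrite mulrDl.
- move=> Xp; have /lideal_euler_opsP[Q ->] : lideal (euler_ops A w beta) (a * p).
    exact/lidealMl/mem_lideal.
  by exists 0, Q; split; [exact: lideal0|rewrite add0r].
move=> Xp; exists (a * p), (fun=> 0); split; first exact/lidealMl/mem_lideal.
by rewrite /euler_sum big1 ?addr0 // => i _; rewrite mul0r.
Qed.

(** The [i]-th Euler operator reads off the degree given by the [i]-th row of
    [tildeA]: commuting it past a homogeneous element adds this degree. As
    [t (t d_t) = (t d_t - 1) t], it is the minus sign of [t d_t] in the weight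
    operator that gives [t] degree 1. *)
Lemma dt_gen_euler i k :
  dt_gen K k * euler_gen i =
  euler_gen i * dt_gen K k + (tildeA A w i k)%:~R *: dt_gen K k.
Proof.
pose sgn : K := if k == t then -1 else 1.
have theta l : dt_gen K k * (wx l * wd l) =
    wx l * wd l * dt_gen K k + (if l == k then sgn *: dt_gen K k else 0).
  rewrite /sgn /dt_gen; case: (split_ordP k) => j ->; rewrite ?eq_lrshift.
    rewrite mulrA wd_wx mulrDl -!mulrA wd_comm; congr (_ + _).
    by rewrite eq_sym; case: eqP => [->|_]; rewrite ?mul1r ?scale1r ?mul0r.
  rewrite (ord1 j) eqxx mulrA wx_comm -!mulrA wd_wx mulrDr -addrA.
  case: eqP => [->|_]; last by rewrite mulr0 !addr0.
  by rewrite mulr1 scaleN1r subrr addr0.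
have sgnE : euler_mx i k * sgn = (tildeA A w i k)%:~R.
  rewrite /sgn /euler_mx /tildeA; case: (split_ordP i) => i' ->;
    case: (split_ordP k) => k' ->; rewrite ?eq_lrshift ?mulr1.
  - by rewrite !block_mxEul mxE.
  - by rewrite !block_mxEur !mxE mul0r.
  - by rewrite !block_mxEdl mxE.
  by rewrite (ord1 k') (ord1 i') eqxx !block_mxEdr !mxE mulrNN mulr1.
rewrite euler_genE mulrBr mulrBl mulr_sumr mulr_suml -scalerAr mulr1 mulr_algl.
rewrite [RHS]addrAC; congr (_ - _).
rewrite (eq_bigr (fun l => euler_mx i l *: (wx l * wd l) * dt_gen K k +
  (if l == k then (euler_mx i l * sgn) *: dt_gen K k else 0))) => [|l _].
  by rewrite big_split -big_mkcond big_pred1_eq /= sgnE.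
rewrite -scalerAr theta scalerDr -scalerAl; congr (_ + _).
by case: eqP; rewrite ?scalerA ?scaler0.
Qed.

Lemma dt_embedX_euler i (u : 'X_{1..N}) :
  (dt_embed 'X_[u] : W) * euler_gen i =
  (euler_gen i + ((tildeA A w *m mnm_col u) i 0)%:~R%:A) * dt_embed 'X_[u].
Proof.
have shiftM (a b : W) (x y : int) :
    a * euler_gen i = (euler_gen i + x%:~R%:A) * a ->
    b * euler_gen i = (euler_gen i + y%:~R%:A) * b ->
  (a * b) * euler_gen i = (euler_gen i + (x + y)%:~R%:A) * (a * b).
  move=> aE bE; rewrite -mulrA bE mulrA mulrDr aE -scalerAr mulr1 intrD scalerDl.
  by rewrite addrA [in RHS]mulrDl mulrDl -!scalerAl mul1r mulrA.
rewrite dt_embedX /mmap1 mxE.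
apply: (big_rec2 (fun (z : int) a => a * euler_gen i = (euler_gen i + z%:~R%:A) * a)).
  by rewrite scale0r addr0 mulr1 mul1r.
move=> k a z _ aE; apply: (shiftM _ _ _ _ _ aE); rewrite [mnm_col u k 0]mxE.
elim: (u k) => [|e IHe].
  by rewrite mulr0 scale0r addr0 mulr1 mul1r.
rewrite exprS intS mulrDr mulr1; apply: shiftM => //.
by rewrite dt_gen_euler mulrDl mulr_algl.
Qed.

Lemma toric_mulr_euler i (p : W) : DI p -> DI (p * euler_gen i).
Proof.
move: p; apply: lideal_ind => [|p q Ip Iq|Q _ [f fI <-]].
- by rewrite mul0r; apply: lideal0.
- by rewrite mulrDl; apply: lidealD.
rewrite -mulrA; apply: lidealMl; move: f fI.
apply: lideal_ind => [|f g If Ig|g _ [u [v [uv ->]]]].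
- by rewrite dt_embed0 mul0r; apply: lideal0.
- by rewrite dt_embedD mulrDl; apply: lidealD.
rewrite dt_embedM -mulrA; apply: lidealMl.
rewrite dt_embedB mulrBl !dt_embedX_euler uv -mulrBr -dt_embedB.
apply/lidealMl/mem_lideal; exists ('X_[u] - 'X_[v]) => //.
by apply: mem_lideal; exists u, v.
Qed.

Variable F : seq 'X_{1..n}.
Hypothesis F_lead : forall f, f \in F ->
  exists2 v, A *m mnm_col v = A *m mnm_col f & wval w v < wval w f.
Hypothesis F_min : forall u v, ~~ has (fun f => f <= u)%MM F ->
  A *m mnm_col u = A *m mnm_col v -> wval w v <= wval w u -> u = v.
Local Notation VF := (supported (in_monomials F) : {pred P}).

Hypothesis F_koszul : forall u : 'I_(d + 1) -> P, \sum_i eul i (u i) \in VF ->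
  exists q : 'I_(d + 1) -> 'I_(d + 1) -> P,
    (forall i j, q j i = - q i j) /\
    forall i, u i - \sum_j eul j (q i j) \in VF.

Lemma weight_diag k m : wt (diag_mnm k + m) = wt m.
Proof.
rewrite weightD weight_tau (diag_mnmE k t).1 (diag_mnmE k t).2.
by rewrite subrr add0r.
Qed.

Lemma wcomp_euler e i p : wcomp (tau n) e (eul i p) = eul i (wcomp (tau n) e p).
Proof.
apply: (linear_mpoly_ext (f := wcomp (tau n) e \o eul i)
  (g := eul i \o wcomp (tau n) e)) => m /=.
have Xm : ('X_[m] : P) \in of_weight (tau n) (wt m).
  by rewrite /of_weight supportedX.
rewrite (wcomp_of_weight _ Xm) (@wcomp_of_weight _ _ (tau n) e (wt m)).
  by case: ifP => // _; rewrite linear0.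
by apply: euler_supported Xm => k m'; rewrite weight_diag.
Qed.

Lemma weight_le_euler e i p :
  p \in weight_le (tau n) e -> eul i p \in weight_le (tau n) e.
Proof. by apply: euler_supported => k m; rewrite weight_diag. Qed.

Lemma euler_sumE (Q : 'I_(d + 1) -> W) : euler_sum Q = \sum_i eul i (Q i) :> P.
Proof. by apply: eq_bigr => i _; rewrite mulr_euler_gen. Qed.

(** If the parts of weight [e] cancel, they are a syzygy of the Euler operators
    modulo the monomial initial ideal. As all such syzygies are generated by
    the Koszul ones, they lift to syzygies modulo the toric ideal itself, and
    subtracting these lowers the weight. *)
Lemma lower_representation e (p : W) (Q : 'I_(d + 1) -> W) :
    DI p -> (p : P) \in weight_le (tau n) e ->
    (forall i, (Q i : P) \in weight_le (tau n) e) ->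
    (p + euler_sum Q : P) \in weight_le (tau n) (e - 1) ->
  exists (p' : W) (Q' : 'I_(d + 1) -> W),
    [/\ DI p', (p' : P) \in weight_le (tau n) (e - 1),
      forall i, (Q' i : P) \in weight_le (tau n) (e - 1) &
      p' + euler_sum Q' = p + euler_sum Q].
Proof.
move=> Ip pe Qe pQ; pose u i : P := wcomp (tau n) e (Q i).
have pV : wcomp (tau n) e p \in VF by apply: toric_initial_sub F_min _ _ Ip pe.
have u0 : wcomp (tau n) e p + \sum_i eul i (u i) = 0.
  rewrite -[RHS](wcomp_lt (tau := tau n) (e := e) _ pQ); last by rewrite ltrBlDr ltrDl.
  rewrite euler_sumE [RHS](linearD (wcomp (tau n) e)) linear_sum /=; congr (_ + _).
  by apply: eq_bigr => i _; rewrite wcomp_euler.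
have [|q [qanti qV]] := F_koszul (u := u).
  by move/eqP: u0; rewrite addrC addr_eq0 => /eqP ->; rewrite rpredN.
pose q' i j : P := wcomp (tau n) e (q i j).
have q'anti i j : q' j i = - q' i j by rewrite /q' qanti linearN.
pose v i : P := u i - \sum_j eul j (q' i j).
have vE i : v i = wcomp (tau n) e (u i - \sum_j eul j (q i j)).
  have ue : u i \in of_weight (tau n) e by apply: of_weight_wcomp.
  rewrite /v (linearB (wcomp (tau n) e)) /= (wcomp_id ue); congr (_ - _).
  rewrite (linear_sum (wcomp (tau n) e)) /=.
  by apply: eq_bigr => j _; rewrite wcomp_euler.
have vV i : v i \in VF by rewrite vE; apply/proj_in/qV.
have lift i : exists l : W, DI l /\ (l : P) \in weight_le (tau n) e /\
    wcomp (tau n) e l = v i.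
  have /(toric_initial F_lead F_min)/initial_lidealE/(_ e) := vV i.
  move=> [l Il [le lv]].
  exists l; split=> //; split=> //; rewrite lv wcomp_id // vE.
  exact: of_weight_wcomp.
have /choice[l lP] := lift.
pose Q' i : W := Q i - \sum_j eul j (q' i j) - l i.
have Q'e i : (Q' i : P) \in weight_le (tau n) (e - 1).
  have [_ [le lv]] := lP i.
  have q'e j : eul j (q' i j) \in of_weight (tau n) e.
    by rewrite /q' -wcomp_euler of_weight_wcomp.
  apply: weight_le_wcomp0.
    rewrite rpredB // rpredB // ?Qe // rpred_sum // => j _.
    exact: of_weight_le.
  rewrite /Q' (linearB (wcomp (tau n) e)) (linearB (wcomp (tau n) e)) /= lv /v.
  rewrite (wcomp_id (p := \sum_j _)) ?subrr // rpred_sum // => j _.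
have pE : p + \sum_i l i * euler_gen i + euler_sum Q' = p + euler_sum Q.
  rewrite -addrA; congr (_ + _).
  rewrite -[\sum_i _]/(euler_sum l) !euler_sumE.
  transitivity (\sum_i eul i (l i) + \sum_i eul i (Q' i) : P) => //.
  transitivity (\sum_i eul i (Q i) : P) => //; rewrite -big_split /=.
  rewrite -[RHS]subr0.
  rewrite -[X in _ = _ - X](sum_euler_antisym euler_mx euler_shift q'anti) -sumrB.
  apply: eq_bigr => i _; rewrite -linearD -linearB; congr (eul i _).
  by rewrite addrC subrK.
exists (p + \sum_i l i * euler_gen i), Q'; split=> //.
  apply: lidealD => //; apply: lideal_sum => i; apply: toric_mulr_euler.
  by have [] := lP i.
have -> : p + \sum_i l i * euler_gen i = p + euler_sum Q - euler_sum Q' :> W.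
  by rewrite -pE addrK.
rewrite rpredB // euler_sumE rpred_sum // => i _.
exact: weight_le_euler.
Qed.

Lemma hypergeometric_representation e (l : W) :
    modified_hypergeometric_ideal A w beta l -> (l : P) \in weight_le (tau n) e ->
  exists (p : W) (Q : 'I_(d + 1) -> W),
    [/\ DI p, (p : P) \in weight_le (tau n) e,
      forall i, (Q i : P) \in weight_le (tau n) e & l = p + euler_sum Q].
Proof.
move=> /hypergeometricP[p [Q [Ip ->]]] le.
have [k pk Qk] : exists2 k : nat, (p : P) \in weight_le (tau n) (e + k%:Z) &
    forall i, (Q i : P) \in weight_le (tau n) (e + k%:Z).
  have /choice[b bP] i := weight_bound (tau n) (Q i : P).
  have [c cP] := weight_bound (tau n) (p : P).
  have le_k (x : nat) : (x <= c + \sum_i b i)%N ->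
      x%:Z <= e + (`|e| + (c + \sum_i b i))%N%:Z.
    move=> xk; rewrite PoszD addrA -[leLHS]add0r lerD ?lez_nat //.
    by rewrite -lerBlDl sub0r abszE -normrN ler_norm.
  exists (`|e| + (c + \sum_i b i))%N.
    by apply: weight_le_trans cP; apply: le_k; apply: leq_addr.
  move=> i; apply: weight_le_trans (bP i); apply: le_k.
  by rewrite (bigD1 i) //= addnCA leq_addr.
elim: k p Q Ip pk Qk le => [|k IHk] p Q Ip pk Qk le.
  by rewrite addr0 in pk Qk; exists p, Q.
have kE : e + k.+1%:Z - 1 = e + k%:Z by rewrite intS (addrC 1) addrA addrK.
have [|p' [Q' [Ip' p'e Q'e pQ]]] := lower_representation Ip pk Qk.
  by apply: weight_le_trans le; rewrite kE lerDl.
by rewrite kE in p'e Q'e; rewrite -pQ in le *; apply: IHk.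
Qed.

Lemma hypergeometric_initial (p : W) :
  initial_ideal (tau n) (modified_hypergeometric_ideal A w beta) p <->
  exists (p' : W) (Q : 'I_(d + 1) -> W), (p' : P) \in VF /\ p = p' + euler_sum Q.
Proof.
split=> [/initial_lidealE H|[p' [Q [p'V ->]]]].
  rewrite [p : P](sum_wcomp (tau n)); elim: (weights _ _) => [|e s [p1 [Q1 [p1V E1]]]].
    exists 0, (fun=> 0); split; first exact: rpred0.
    by rewrite big_nil /euler_sum big1 ?addr0 // => i _; rewrite mul0r.
  have [l Il [le lE]] := H e.
  have [p2 [Q2 [Ip2 p2e Q2e lpQ]]] := hypergeometric_representation Il le.
  exists (wcomp (tau n) e p2 + p1), (fun i => (wcomp (tau n) e (Q2 i) : W) + Q1 i).
  split; first by rewrite rpredD //; apply: toric_initial_sub F_min _ _ Ip2 p2e.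
  rewrite big_cons E1 -lE lpQ (linearD (wcomp (tau n) e)) /=.
  have -> : wcomp (tau n) e (euler_sum Q2) =
      euler_sum (fun i => wcomp (tau n) e (Q2 i)) :> W.
    rewrite !euler_sumE (linear_sum (wcomp (tau n) e)).
    by apply: eq_bigr => i _; rewrite /= wcomp_euler.
  rewrite addrACA; congr (_ + _); rewrite /euler_sum -big_split.
  by apply: eq_bigr => i _; rewrite mulrDl.
apply: lspanD.
  apply/initial_lidealE => e.
  have /(toric_initial F_lead F_min)/initial_lidealE/(_ e)[l Il le] := p'V.
  exists l => //; apply/hypergeometricP; exists l, (fun=> 0); split=> //.
  by rewrite /euler_sum big1 ?addr0 // => i _; rewrite mul0r.
apply/initial_lidealE => e; exists (euler_sum (fun i => wcomp (tau n) e (Q i))).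
  apply/hypergeometricP; exists 0, (fun i => wcomp (tau n) e (Q i)).
  by split; [exact: lideal0|rewrite add0r].
have QE : wcomp (tau n) e (euler_sum Q) =
      euler_sum (fun i => wcomp (tau n) e (Q i)) :> W.
  rewrite !euler_sumE (linear_sum (wcomp (tau n) e)).
  by apply: eq_bigr => i _; rewrite /= wcomp_euler.
rewrite -QE; split; first exact/of_weight_le/of_weight_wcomp.
exact/wcomp_id/of_weight_wcomp.
Qed.

End Hypergeometric.

(** * Finiteness of minimal elements, and generic weights *)

(** The induction is on the number of coordinates that are compared. Representatives
    [F0] that are minimal up to coordinate [k] also work for all elements whose
    coordinate [k] exceeds that of every [f] in [F0]; below this bound there are
    finitely many values of the coordinate [k], each treated by induction. *)
Lemma dickson_fun k (U : (nat -> nat) -> Prop) :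
  exists F : seq (nat -> nat),
    (forall f, List.In f F -> U f) /\
    forall u, U u -> exists2 f, List.In f F & forall i, (i < k)%N -> (f i <= u i)%N.
Proof.
elim: k U => [|k IHk] U.
  have [[u Uu]|U0] := pselect (exists u, U u).
    by exists [:: u]; split=> [f [<-|[]] //|v _]; exists u => //; left.
  by exists [::]; split=> // u Uu; case: U0; exists u.
have [F0 [F0U F0min]] := IHk U.
pose b := \max_(f <- F0) (f k).+1.
have [F1 [F1U F1min]] : exists F1 : seq (nat -> nat),
    (forall f, List.In f F1 -> U f) /\
    forall u, U u -> (u k < b)%N ->
      exists2 f, List.In f F1 & forall i, (i < k.+1)%N -> (f i <= u i)%N.
  elim: b => [|b [F [FU Fmin]]]; first by exists [::].
  have [G [GU Gmin]] := IHk (fun u => U u /\ u k = b).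
  exists (G ++ F); split=> [f /List.in_app_iff[/GU[]|/FU]//|u Uu].
  rewrite ltnS leq_eqVlt => /orP[/eqP ub|/(Fmin _ Uu)[f fF fu]]; last first.
    by exists f => //; apply/List.in_app_iff; right.
  have [f fG fu] := Gmin u (conj Uu ub); exists f.
    by apply/List.in_app_iff; left.
  move=> i; rewrite ltnS leq_eqVlt => /orP[/eqP ->|]; last exact: fu.
  by have [_ ->] := GU f fG; rewrite ub.
exists (F0 ++ F1); split=> [f /List.in_app_iff[/F0U|/F1U]//|u Uu].
have [ub|ub] := ltnP (u k) b.
  have [f fF1 fu] := F1min u Uu ub.
  by exists f => //; apply/List.in_app_iff; right.
have [f fF0 fu] := F0min u Uu; exists f; first by apply/List.in_app_iff; left.
move=> i; rewrite ltnS leq_eqVlt => /orP[/eqP ->|]; last exact: fu.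
apply: leq_trans ub; rewrite /b; clear -fF0.
elim: F0 fF0 => //= g F0 IHF [->|/IHF fb]; rewrite big_cons.
  by apply: leq_trans (leq_maxl _ _); apply: leqnSn.
exact: leq_trans (leq_maxr _ _).
Qed.

Lemma dickson k (U : 'X_{1..k} -> Prop) :
  exists F : seq 'X_{1..k}, (forall f, f \in F -> U f) /\
    forall u, U u -> has (fun f => f <= u)%MM F.
Proof.
pose to_mnm (f : nat -> nat) : 'X_{1..k} := [multinom f i | i < k].
have [F [FU Fmin]] := dickson_fun k (fun f => U (to_mnm f)).
exists [seq to_mnm f | f <- F]; split.
  elim: F FU {Fmin} => //= g F IHF FU f; rewrite inE => /orP[/eqP ->|].
    by apply: FU; left.
  by apply: IHF => h hF; apply: FU; right.
move=> u Uu; have [|f fF fu] := Fmin (fun i => nth 0%N u i).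
  rewrite (_ : to_mnm _ = u) //; apply/mnmP => i.
  by rewrite mnmE -mnm_nth.
elim: F fF {FU Fmin} => //= g F IHF [->|/IHF ->]; last by rewrite orbT.
apply/orP; left; apply/mnm_lepP => i; rewrite mnmE (mnm_nth 0%N).
exact: fu.
Qed.

Section GenericWeight.
Variables (d n : nat) (A : 'M[int]_(d, n)).
Implicit Types (w : 'rV[int]_n) (u v : 'X_{1..n}).

Lemma wvalD w u v : wval w (u + v) = wval w u + wval w v.
Proof. by rewrite /wval mnm_colD mulmxDr mxE. Qed.

(** It suffices that no minimal pair of distinct elements in a common fiber of
    [A] be balanced for [w]: two minimizers would differ by such a pair. *)
Lemma generic_weight :
  exists hs : seq 'rV[int]_n, (forall h, h \in hs -> h != 0) /\
    forall w, (forall h, h \in hs -> \sum_(j < n) h 0 j * w 0 j != 0) ->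
    forall u v,
      (forall u', A *m mnm_col u' = A *m mnm_col u -> wval w u <= wval w u') ->
      A *m mnm_col v = A *m mnm_col u -> wval w v <= wval w u -> u = v.
Proof.
pose lp (x : 'X_{1..n + n}) : 'X_{1..n} := [multinom x (lshift n j) | j < n].
pose rp (x : 'X_{1..n + n}) : 'X_{1..n} := [multinom x (rshift n j) | j < n].
have lpE x j : lp x j = x (lshift n j) by rewrite mnmE.
have rpE x j : rp x j = x (rshift n j) by rewrite mnmE.
have [F [FU Fmin]] := dickson (fun x : 'X_{1..n + n} =>
  lp x != rp x /\ A *m mnm_col (lp x) = A *m mnm_col (rp x)).
pose h x : 'rV[int]_n := \row_j ((lp x j)%:Z - (rp x j)%:Z).
exists [seq h x | x <- F]; split=> [_ /mapP[x /FU[xlr _] ->]|w hw u v umin vu wvu].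
  apply: contra_neq xlr => /rowP x0; apply/mnmP => j.
  by have := x0 j; rewrite !mxE => /eqP; rewrite subr_eq0 => /eqP[].
apply: contrapT => uv.
pose x : 'X_{1..n + n} :=
  [multinom match split k with inl j => u j | inr j => v j end | k < n + n].
have xl : lp x = u.
  by apply/mnmP => j; rewrite !mnmE -[lshift n j]/(unsplit (inl j)) unsplitK.
have xr : rp x = v.
  by apply/mnmP => j; rewrite !mnmE -[rshift n j]/(unsplit (inr j)) unsplitK.
have /hasP[f fF fx] : has (fun y => y <= x)%MM F.
  by apply: Fmin; rewrite xl xr; split; [exact/eqP|].
have [_ fA] := FU f fF.
have fu : (lp f <= u)%MM.
  by rewrite -xl; apply/mnm_lepP => j; rewrite !lpE; apply: (mnm_lepP fx).
have fv : (rp f <= v)%MM.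
  by rewrite -xr; apply/mnm_lepP => j; rewrite !rpE; apply: (mnm_lepP fx).
(* Both [u - lp f + rp f] and [v - rp f + lp f] lie in the common fiber, so the
   minimality of [u] and [v] bounds [w] on [lp f - rp f] from both sides. *)
have le1 : wval w (lp f) <= wval w (rp f).
  have := umin (u - lp f + rp f)%MM; rewrite -{2 3}(submK fu) !mnm_colD !mulmxDr fA.
  by move=> /(_ erefl); rewrite !wvalD lerD2l.
have le2 : wval w (rp f) <= wval w (lp f).
  have := umin (v - rp f + lp f)%MM; rewrite -vu -{2}(submK fv) !mnm_colD !mulmxDr fA.
  move=> /(_ erefl) /(le_trans wvu); rewrite -{1}(submK fv) !wvalD.
  by rewrite lerD2l.
have /negP := hw (h f) (map_f h fF); apply; apply/eqP.
have hE : \sum_(j < n) h f 0 j * w 0 j = wval w (lp f) - wval w (rp f).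
  rewrite /wval !mxE -sumrB; apply: eq_bigr => j _.
  by rewrite /h !mxE mulrBl ![_ * w 0 j]mulrC.
by rewrite hE; apply/eqP; rewrite subr_eq0 eq_le le1 le2.
Qed.

End GenericWeight.

(** * Exactness on the standard cells *)

(** Clearing denominators turns a rational kernel vector into an integral one. *)
Lemma rat_kernel d n (A : 'M[int]_(d, n)) (S : pred 'I_n) (y : 'cV[rat]_n) :
    (forall z : 'cV[int]_n, (forall j, ~~ S j -> z j 0 = 0) -> A *m z = 0 -> z = 0) ->
    (forall j, ~~ S j -> y j 0 = 0) -> map_mx intr A *m y = 0 -> y = 0.
Proof.
move=> Aker yS Ay; pose D : int := \prod_j denq (y j 0).
pose z : 'cV[int]_n := \col_j (numq (y j 0) * \prod_(l | l != j) denq (y l 0)).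
have zE j : (z j 0)%:~R = D%:~R * y j 0.
  have DE : D = denq (y j 0) * \prod_(l | l != j) denq (y l 0) by apply: bigD1.
  by rewrite mxE DE !intrM numqE -[LHS]mulrA [LHS]mulrC.
have D0 : D%:~R != 0 :> rat by rewrite intr_eq0; apply/prodf_neq0 => j _.
have z0 : z = 0.
  apply: Aker => [j /yS yj|].
    by apply/eqP; rewrite -(intr_eq0 rat) zE yj mulr0.
  apply/colP => i; rewrite [LHS]mxE [RHS]mxE; apply/eqP.
  rewrite -(intr_eq0 rat) rmorph_sum /=.
  under eq_bigr do rewrite rmorphM /= zE mulrCA.
  rewrite -mulr_sumr; have := congr1 (fun M : 'cV_d => M i 0) Ay.
  rewrite !mxE (eq_bigr (fun j => (A i j)%:~R * y j 0)) => [->|j _].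
    by rewrite mulr0.
  by rewrite mxE.
apply/colP => j; rewrite mxE; have := zE j; rewrite z0 mxE => /esym/eqP.
by rewrite mulf_eq0 (negbTE D0) => /eqP.
Qed.

Section StandardCells.
Variables (K : numFieldType) (d n : nat) (A : 'M[int]_(d, n)) (w : 'rV[int]_n).
Variable F : seq 'X_{1..n}.
Hypothesis F_min : forall u v, ~~ has (fun f => f <= u)%MM F ->
  A *m mnm_col u = A *m mnm_col v -> wval w v <= wval w u -> u = v.
Local Notation N := (n + 1)%N.
Local Notation P := {mpoly K[N + N]}.
Local Notation t := (rshift n ord0 : 'I_N).
Local Notation xi k := (lshift N k).
Local Notation di k := (rshift N k).

Definition exponent_bound : nat := \max_(f <- F) mdeg f.
Local Notation b := exponent_bound.

(** Membership in the monomial ideal generated by [F] does not see exponents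
    above [exponent_bound], nor the exponents of [d_t]. *)
Definition cell_bound (k : 'I_N) : 'I_b.+1 := if k == t then ord0 else ord_max.

Local Notation cellT := {ffun 'I_N -> 'I_b.+1}.

(** A function [c] with [c t != ord0] is not the cell of any monomial. Such [c]
    are included only to exclude them from the cells that remain to be treated. *)
Definition lead_cells : {set cellT} :=
  [set c : cellT | (c t != ord0) ||
     has (fun f : 'X_{1..n} => [forall j, (f j <= c (lshift 1 j))%N]) F]%SET.

Lemma exponent_boundP f j : f \in F -> (f j <= b)%N.
Proof.
move=> fF; apply: leq_trans (leq_bigmax_seq _ fF isT).
by rewrite mdegE (bigD1 j) //= leq_addr.
Qed.

Lemma cell_bound_l j : cell_bound (lshift 1 j) = b :> nat.
Proof. by rewrite /cell_bound eq_lrshift. Qed.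

Lemma lead_cellsE m : (cell cell_bound m \in lead_cells) = in_monomials F m.
Proof.
rewrite inE -val_eqE /= cellE /cell_bound eqxx /=.
apply: eq_in_has => f fF; apply/forallP/mnm_lepP => fm j.
  have := fm j; rewrite cellE cell_bound_l leq_min -dpartE => /andP[].
  by [].
rewrite cellE cell_bound_l leq_min exponent_boundP // andbT.
by have := fm j; rewrite dpartE.
Qed.

Lemma upclosed_lead_cells : upclosed cell_bound lead_cells.
Proof.
move=> k m; rewrite !lead_cellsE => /hasP[f fF fm]; apply/hasP; exists f => //.
apply: lepm_trans fm _; apply/mnm_lepP => j.
by rewrite !dpartE mnmDE leq_addl.
Qed.

(** Two distinct elements of a cell lying in the same fiber of [A] would both
    be standard, so the columns of [A] along the unbounded directions of a
    standard cell are independent. *)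
Lemma standard_cell_kernel (c : cellT) (z : 'cV[int]_n) : c \notin lead_cells ->
    (forall j, ~~ (c (lshift 1 j) == b :> nat) -> z j 0 = 0) -> A *m z = 0 -> z = 0.
Proof.
rewrite inE negb_or => /andP[_ /hasPn cF] zc Az.
(* Both [u] and [v] lie in the cell [c], and they differ by [z]. *)
pose u : 'X_{1..n} := [multinom (c (lshift 1 j) + absz (Num.max (z j 0) 0)%R)%N | j < n].
pose v : 'X_{1..n} := [multinom (c (lshift 1 j) + absz (Num.max (- z j 0) 0)%R)%N | j < n].
have std (x : 'X_{1..n}) :
    (forall j, ~~ (c (lshift 1 j) == b :> nat) -> x j = c (lshift 1 j)) ->
    ~~ has (fun f => f <= x)%MM F.
  move=> xc; apply/hasPn => f fF; apply: contra (cF f fF) => /mnm_lepP fx.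
  apply/forallP => j; have [->|/xc <-//] := eqVneq (c (lshift 1 j) : nat) b.
  exact: exponent_boundP.
have zuv j : z j 0 = (u j)%:Z - (v j)%:Z.
  rewrite !mnmE !PoszD opprD addrACA subrr add0r !gez0_abs ?le_max ?lexx ?orbT //.
  case: (lerP 0 (z j 0)) => z0.
    by rewrite max_r ?oppr_le0 // subr0.
  by rewrite max_l ?oppr_ge0 ?(ltW z0) // sub0r opprK.
have uvA : A *m mnm_col u = A *m mnm_col v.
  apply/eqP; rewrite -subr_eq0 -mulmxBr -Az; apply/eqP; congr (_ *m _).
  by apply/colP => j; rewrite zuv !mxE.
have us : ~~ has (fun f => f <= u)%MM F.
  by apply: std => j /zc z0; rewrite mnmE z0 maxxx addn0.
have vs : ~~ has (fun f => f <= v)%MM F.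
  by apply: std => j /zc z0; rewrite mnmE z0 oppr0 maxxx addn0.
have uv : u = v.
  by case/orP: (le_total (wval w v) (wval w u)) => [|vu]; [apply: F_min|apply/esym/F_min].
by apply/colP => j; rewrite zuv uv subrr mxE.
Qed.

Lemma standard_cellE (c : cellT) k : c \notin lead_cells ->
  (c k == cell_bound k) =
  match split k with inl j => c (lshift 1 j) == b :> nat | inr _ => true end.
Proof.
rewrite inE negb_or negbK => /andP[/eqP ct _]; case: (split_ordP k) => j ->.
  by rewrite -val_eqE /= cell_bound_l.
by rewrite (ord1 j) ct /cell_bound eqxx.
Qed.

(** [A D] has rank [d] by hypothesis and independent nonzero columns by
    [standard_cell_kernel], so a right inverse supported on [S] is also a left
    inverse on [S]. *)
Lemma standard_cell_inverse (c : cellT) (S := fun j => c (lshift 1 j) == b :> nat)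
    (D := diag_mx (\row_j (S j)%:R) : 'M[rat]_n) :
    c \notin lead_cells -> row_free (map_mx intr A *m D) ->
  exists C : 'M[K]_(n, d), [/\ map_mx intr A *m C = 1%:M,
    forall j i, ~~ S j -> C j i = 0 &
    forall j l, S l -> (C *m map_mx intr A) j l = (j == l)%:R].
Proof.
move=> cF /row_freeP[C0 AC0]; have DS m (M : 'M[rat]_(n, m)) j i : ~~ S j -> (D *m M) j i = 0.
  by move=> /negbTE Sj; rewrite mul_diag_mx !mxE Sj mul0r.
have [C AC CS] : exists2 C : 'M[rat]_(n, d), map_mx intr A *m C = 1%:M &
    forall j i, ~~ S j -> C j i = 0.
  by exists (D *m C0); [rewrite mulmxA|move=> j i; apply: DS].
have CAD : C *m map_mx intr A *m D = D.
  apply/eqP; rewrite -subr_eq0; apply/eqP; set X := _ - _.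
  have AX : map_mx intr A *m X = 0.
    by rewrite /X mulmxBr !mulmxA AC mul1mx subrr.
  apply/matrixP => j l; have /colP/(_ j) : col l X = 0.
    apply: (rat_kernel (A := A) (S := S)) => [z zS Az|k Sk|].
    - exact: standard_cell_kernel cF zS Az.
    - rewrite !mxE (negbTE Sk) mul0rn subr0 big1 // => k' _.
      by rewrite [X in X * _]mxE big1 ?mul0r // => i _; rewrite CS ?mul0r.
    - by rewrite colE mulmxA AX mul0mx.
  by rewrite !mxE.
have mapA : map_mx intr A = map_mx ratr (map_mx intr A : 'M[rat]_(d, n)) :> 'M[K]_(d, n).
  by apply/matrixP => i j; rewrite !mxE ratr_int.
exists (map_mx ratr C); split=> [|j i Sj|j l Sl].
- by rewrite mapA -map_mxM AC map_mx1.
- by rewrite mxE CS // rmorph0.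
rewrite mapA -map_mxM mxE.
have := congr1 (fun M : 'M_n => M j l) CAD; rewrite /= mul_mx_diag !mxE Sl mulr1 => ->.
by case: eqP => [->|_]; rewrite ?Sl ?mulr1n ?mulr0n ?rmorph1 ?rmorph0.
Qed.

(** The inverse [C] of the block of [A] is completed by the row and the column of
    [t] in [euler_mx]. *)
Lemma standard_cell_exact1 (c : cellT) (beta : 'cV[K]_d) (C : 'M[K]_(n, d)) :
    c \notin lead_cells -> map_mx intr A *m C = 1%:M ->
    (forall j i, c (lshift 1 j) != b :> nat -> C j i = 0) ->
    (forall j l, c (lshift 1 l) == b :> nat ->
       (C *m map_mx intr A) j l = (j == l)%:R) ->
  cell_exact cell_bound (euler_mx K A w) (euler_shift beta) c.
Proof.
move=> cF AC C0 CA; right.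
pose wK : 'rV[K]_n := map_mx intr w.
pose G : 'M[K]_(n + 1, d + 1) := block_mx C 0 (wK *m C) (-1)%:M.
have BG : euler_mx K A w *m G = 1%:M.
  rewrite mulmx_block AC -scalar_mxM mulrNN mulr1 !mulmx0 !mul0mx !addr0 add0r.
  by rewrite mul_scalar_mx scaleN1r addrN -scalar_mx_block.
exists G; split=> [i j|k l].
  have := congr1 (fun M : 'M_(d + 1) => M i j) BG; rewrite !mxE => <-.
  rewrite [RHS](bigID (fun k => c k == cell_bound k)) /= [X in _ = _ + X]big1 ?addr0 //.
  move=> k; rewrite standard_cellE //; case: (split_ordP k) => j' -> // cj.
  case: (split_ordP j) => i' ->; first by rewrite block_mxEul C0 ?mulr0.
  by rewrite block_mxEur [X in _ * X]mxE mulr0.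
move=> /eqP; rewrite standard_cellE // => kc /eqP; rewrite standard_cellE // => lc.
have -> : \sum_i G k i * euler_mx K A w i l = (G *m euler_mx K A w) k l by rewrite mxE.
rewrite mulmx_block -scalar_mxM mulrNN mulr1 !mulmx0 !mul0mx !addr0 add0r.
rewrite mul_scalar_mx scaleN1r -mulmxA.
case: (split_ordP k) kc => k' -> kc; case: (split_ordP l) lc => l' -> lc.
- by rewrite block_mxEul CA // eq_lshift.
- by rewrite block_mxEur mxE eq_lrshift.
- rewrite block_mxEdl eq_rlshift mxE [X in X + _]mxE (bigD1 l') //= CA // eqxx mulr1.
  rewrite big1 ?addr0 => [|j jl]; first by rewrite !mxE subrr.
  by rewrite CA // (negbTE jl) mulr0.
by rewrite block_mxEdr mxE eq_rshift.
Qed.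

(** The polynomial [L] is 1 or the equation of a hyperplane. Its restriction [p]
    to the moment curve [(s, s^2, ..., s^d)] is recorded because a point avoiding
    finitely many such hyperplanes is found on that curve. *)
Lemma standard_cell_exact (c : cellT) : c \notin lead_cells ->
  exists (L : {mpoly K[d]}) (p : {poly K}), [/\ p != 0,
    forall s, L.@[fun i => s ^+ i.+1] = p.[s] &
    forall beta : 'cV[K]_d, L.@[fun i => beta i 0] != 0 ->
      cell_exact cell_bound (euler_mx K A w) (euler_shift beta) c].
Proof.
move=> cF; pose S j := c (lshift 1 j) == b :> nat.
pose D : 'M[rat]_n := diag_mx (\row_j (S j)%:R).
have [AD|AD] := boolP (row_free (map_mx intr A *m D)).
  have [C [AC C0 CA]] := standard_cell_inverse cF AD.
  exists 1, 1; split=> [|s|beta _]; rewrite ?oner_eq0 ?hornerC ?rmorph1 //.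
  exact: standard_cell_exact1 AC C0 CA.
have /rowV0Pn[y] : kermx (map_mx intr A *m D) != 0 by rewrite kermx_eq0.
move=> /sub_kermxP yAD /eqP y0.
pose yK i : K := ratr (y 0 i).
have yA j : S j -> \sum_i yK i * (A i j)%:~R = 0.
  move=> Sj; have := congr1 (fun M : 'rV_n => ratr (M 0 j) : K) yAD.
  rewrite /= mulmxA mul_mx_diag !mxE Sj mulr1 rmorph_sum rmorph0 /= => yE.
  by rewrite -[RHS]yE; apply: eq_bigr => i _; rewrite rmorphM /= mxE ratr_int.
pose e := \sum_i yK i * \sum_(k | c k != cell_bound k)
  euler_mx K A w (lshift 1 i) k * (c k)%:R.
exists (\sum_i yK i *: 'X_i - e%:MP), (\sum_i yK i *: 'X^(i.+1) - e%:P); split.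
- have [i yi] : exists i, y 0 i != 0.
    apply: contrapT => ny; apply: y0; apply/rowP => i; rewrite mxE.
    by apply/eqP; apply: contrapT => /negP yi; apply: ny; exists i.
  apply/eqP => /(congr1 (fun p : {poly K} => p`_i.+1)) /eqP.
  rewrite coefB coefC subr0 coef0 coef_sum (bigD1 i) //= big1 ?addr0.
    by rewrite coefZ coefXn eqxx mulr1 fmorph_eq0 (negbTE yi).
  move=> j ji; rewrite coefZ coefXn eqSS eq_sym.
  by rewrite (inj_eq val_inj) (negbTE ji) mulr0.
- move=> s; rewrite hornerD hornerN hornerC horner_sum mevalB mevalC raddf_sum.
  by congr (_ - _); apply: eq_bigr => i _; rewrite /= mevalZ mevalXU hornerZ hornerXn.
move=> beta; rewrite mevalB mevalC raddf_sum /= => Lb; left.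
exists (fun i => match split i with inl i' => yK i' | inr _ => 0 end); split.
  move=> k /eqP; rewrite standard_cellE // big_split_ord big_ord1 /=.
  rewrite -[rshift d ord0]/(unsplit (inr ord0)) unsplitK mul0r addr0.
  under eq_bigr => i _ do rewrite -[lshift 1 i]/(unsplit (inl i)) unsplitK /=.
  case: (split_ordP k) => j -> Sj.
    by rewrite -[RHS](yA j Sj); apply: eq_bigr => i _; rewrite block_mxEul mxE.
  by apply: big1 => i _; rewrite block_mxEur mxE mulr0.
apply: contra_neq Lb; rewrite big_split_ord big_ord1 /=.
rewrite -[rshift d ord0]/(unsplit (inr ord0)) unsplitK mul0r addr0.
under eq_bigr => i _ do rewrite -[lshift 1 i]/(unsplit (inl i)) unsplitK /=.
under eq_bigr => i _ do rewrite /cell_const /euler_shift -[lshift 1 i]/(unsplit (inl i)) unsplitK mulrBr /=.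
rewrite sumrB => /eqP; rewrite subr_eq0 eq_sym => /eqP eL.
apply/eqP; rewrite subr_eq0; apply/eqP; rewrite -[RHS]eL.
by apply: eq_bigr => i _; rewrite mevalZ mevalXU.
Qed.

End StandardCells.

(** * The initial ideal for generic parameters *)

(** The exponents of [d_1, ..., d_n] never decrease under left multiplication. *)
Lemma in_monomials_mull (R : comNzRingType) n (F : seq 'X_{1..n})
    (a p : weyl R (n + 1)) :
  (p : {mpoly R[_]}) \in supported (in_monomials F) ->
  (a * p : {mpoly R[_]}) \in supported (in_monomials F).
Proof.
move=> pF; elim/weyl_ind: a => [|a b IHa IHb|c a IHa|i a IHa|i a IHa].
- by rewrite mul1r.
- by rewrite mulrDl; apply: rpredD.
- by rewrite -scalerAl; apply: rpredZ.
- rewrite -mulrA wx_mulE; apply: mulX_supported IHa => m /hasP[f fF fm].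
  apply/hasP; exists f => //; apply: lepm_trans fm _; apply/mnm_lepP => j.
  by rewrite !dpartE mnmDE leq_addl.
rewrite -mulrA wd_mulE; apply: rpredD.
  apply: mulX_supported IHa => m /hasP[f fF fm].
  apply/hasP; exists f => //; apply: lepm_trans fm _; apply/mnm_lepP => j.
  by rewrite !dpartE mnmDE leq_addl.
apply: (linear_supported (f := mderiv (lshift (n + 1) i))) IHa => m mF /=.
rewrite mderivX rpredZ // supportedX /in_monomials.
rewrite (_ : dpart _ = dpart m) //; apply/mnmP => j.
by rewrite !dpartE mnmBE mnm1E eq_lrshift subn0.
Qed.

Lemma exists_nonroot (K : numFieldType) (p : {poly K}) : p != 0 ->
  exists s, p.[s] != 0.
Proof.
move=> p0; apply: contrapT => none.
have /(max_poly_roots p0) : all (root p) [seq i%:R : K | i <- iota 0 (size p)].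
  by apply/allP => s _; apply/eqP; apply: contrapT => /eqP sp; apply: none; exists s.
rewrite map_inj_uniq ?iota_uniq; last by move=> i j /eqP; rewrite eqr_nat => /eqP.
by move=> /(_ isT); rewrite size_map size_iota ltnn.
Qed.

Lemma initial_hypergeometric_generic (K : numFieldType) (d n : nat)
    (A : 'M[int]_(d, n)) :
  exists hs : seq 'rV[int]_n, (forall h, h \in hs -> h != 0) /\
    forall w : 'rV[int]_n,
      (forall h, h \in hs -> \sum_(j < n) h 0 j * w 0 j != 0) ->
      exists Z : set 'cV[K]_d, zariski_closed Z /\ Z <> setT /\
        forall beta : 'cV[K]_d, ~ Z beta ->
          initial_ideal (tau n) (modified_hypergeometric_ideal A w beta) =
          [set p + q | p in lideal (initial_ideal (tau n)
                                      (lideal (toric_ops A w)))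
                     & q in lideal (euler_ops A w beta)].
Proof.
have [hs [hs0 hsP]] := generic_weight A; exists hs; split=> // w /hsP w_generic.
have [F [F_lead F_gen]] := dickson (fun u =>
  exists2 v, A *m mnm_col v = A *m mnm_col u & wval w v < wval w u).
have F_min u v : ~~ has (fun f => f <= u)%MM F ->
    A *m mnm_col u = A *m mnm_col v -> wval w v <= wval w u -> u = v.
  move=> uF uv; apply: w_generic => // u' u'u; rewrite leNgt.
  by apply: contra uF => u'w; apply: F_gen; exists u'.
have /choice[L LP] : forall c : {ffun 'I_(n + 1) -> 'I_(exponent_bound F).+1},
    exists Lp : {mpoly K[d]} * {poly K}, c \notin lead_cells F ->
    [/\ Lp.2 != 0, forall s, Lp.1.@[fun i => s ^+ i.+1] = Lp.2.[s] &
    forall beta : 'cV[K]_d, Lp.1.@[fun i => beta i 0] != 0 ->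
      cell_exact (cell_bound F) (euler_mx K A w) (euler_shift beta) c].
  move=> c; have [|cF] := boolP (c \in lead_cells F); first by exists (0, 0).
  by have [M [p ?]] := standard_cell_exact K F_min cF; exists (M, p).
pose Q : {mpoly K[d]} := \prod_(c | c \notin lead_cells F) (L c).1.
exists [set b : 'cV[K]_d | Q.@[fun i => b i 0] = 0]; split; [|split].
- exists [set Q]; apply/seteqP; split=> b /= bQ; first by move=> _ ->.
  exact: bQ.
- have [s sP] : exists s, (\prod_(c | c \notin lead_cells F) (L c).2).[s] != 0.
    by apply: exists_nonroot; apply/prodf_neq0 => c /LP[].
  move=> /seteqP[_ /(_ (\col_i s ^+ i.+1) I)] /eqP; apply/negP.
  move: sP; rewrite horner_prod => /prodf_neq0 sP.
  rewrite rmorph_prod; apply/prodf_neq0 => c cF.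
  have [_ Ls _] := LP c cF; rewrite /=.
  rewrite (_ : (fun i => _) = (fun i : 'I_d => s ^+ i.+1)); first by rewrite Ls sP.
  by apply/funext => i; rewrite mxE.
move=> beta /eqP; rewrite rmorph_prod => /prodf_neq0 Qbeta.
have F_koszul (u : 'I_(d + 1) -> {mpoly K[(n + 1) + (n + 1)]}) :
    \sum_i euler (euler_mx K A w) (euler_shift beta) i (u i) \in supported (in_monomials F) ->
    exists q : 'I_(d + 1) -> 'I_(d + 1) -> {mpoly K[(n + 1) + (n + 1)]},
      (forall i j, q j i = - q i j) /\
      forall i, u i - \sum_j euler (euler_mx K A w) (euler_shift beta) j (q i j)
        \in supported (in_monomials F).
  have spanE p : (p \in cell_span (cell_bound F) (lead_cells F)) =
      (p \in supported (in_monomials F)) :> bool.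
    by apply: eq_all => m; apply: lead_cellsE.
  rewrite -spanE => uE.
  have [|c cF|q [qanti qE]] := euler_koszul_exact _ _ uE.
  - exact: upclosed_lead_cells.
  - by have [_ _] := LP c cF; apply; apply: Qbeta.
  by exists q; split=> // i; rewrite -spanE.
have VF (p : weyl K (n + 1)) :
    lideal (initial_ideal (tau n) (lideal (toric_ops A w))) p <->
    (p : {mpoly K[_]}) \in supported (in_monomials F).
  split=> [|pF]; last exact/mem_lideal/(toric_initial F_lead F_min).
  move: p; apply: lideal_ind => [|p q|a p /(toric_initial F_lead F_min)].
  - exact: rpred0.
  - exact: rpredD.
  exact: in_monomials_mull.
apply/seteqP; split=> x.
  move/(hypergeometric_initial F_lead F_min F_koszul) => [p [Q' [pF ->]]].
  exists p; first exact/VF.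
  by exists (euler_sum A w beta Q') => //; apply/lideal_euler_opsP; exists Q'.
move=> [p /VF pF [q /lideal_euler_opsP[Q' ->] <-]].
by apply/(hypergeometric_initial F_lead F_min F_koszul); exists p, Q'.
Qed.

Theorem theorem2 (R : realType) (d n : nat) (A : 'M[int]_(d, n))
    (A_span : forall v : 'cV[int]_d, exists u : 'cV[int]_n, A *m u = v) :
  exists hs : seq 'rV[int]_n,
    (forall h, h \in hs -> h != 0) /\
    forall w : 'rV[int]_n,
      (forall h, h \in hs -> \sum_(j < n) h 0 j * w 0 j != 0) ->
      exists Z : set 'cV[R[i]]_d,
        zariski_closed Z /\ Z <> setT /\
        forall beta : 'cV[R[i]]_d, ~ Z beta ->
          initial_ideal (tau n) (modified_hypergeometric_ideal A w beta) =
          [set p + q | p in lideal (initial_ideal (tau n)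
                                      (lideal (toric_ops A w)))
                     & q in lideal (euler_ops A w beta)].
Proof. exact: (initial_hypergeometric_generic R[i] A). Qed.
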